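(* Let $A$ be a ring and let $\mathscr{T}=(\mathfrak{C},B,\langle -,-\rangle)$ be a right rational pairing over $A$ with rational functor $\mathrm{Rat}^{\mathscr{T}}:\mathsf{Mod}_B\to\mathsf{Mod}_B$, and put $\mathfrak{a}=\mathrm{Rat}^{\mathscr{T}}(B_B)$, $\mathcal{K}=\mathsf{Ker}(\mathrm{Rat}^{\mathscr{T}})$. Let $\mathfrak{l}:\mathrm{Rat}^{\mathscr{T}}(\mathsf{Mod}_B)\to\mathsf{Mod}_B$ be the inclusion functor. The following statements are equivalent. (i) $\mathrm{Rat}^{\mathscr{T}}:\mathsf{Mod}_B\to\mathsf{Mod}_B$ is an exact functor. (ii) $\mathcal{K}$ is a localizing subcategory of $\mathsf{Mod}_B$ with canonical functor $\mathbf{T}:\mathsf{Mod}_B\to\mathsf{Mod}_B/\mathcal{K}$, and there exists an equivalence $H:\mathsf{Mod}_B/\mathcal{K}\to\mathrm{Rat}^{\mathscr{T}}(\mathsf{Mod}_B)$ such that $\mathrm{Rat}^{\mathscr{T}}=H\circ\mathbf{T}$. (iii) The functor $F=\mathrm{Hom}_B(\mathfrak{a}_B,-)\circ\mathfrak{l}:\mathrm{Rat}^{\mathscr{T}}(\mathsf{Mod}_B)\to\mathsf{Mod}_B$ is right adjoint to $\mathrm{Rat}^{\mathscr{T}}$ (viewed as a functor $\mathsf{Mod}_B\to\mathrm{Rat}^{\mathscr{T}}(\mathsf{Mod}_B)$). (iv) $\mathfrak{a}$ is a (left) idempotent $B$-coring and the forgetful functor $U:\mathsf{Comod}_{\mathfrak{a}}\to\mathsf{Mod}_B$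 induces an isomorphism of categories $\mathsf{Comod}_{\mathfrak{a}}\cong\mathrm{Rat}^{\mathscr{T}}(\mathsf{Mod}_B)\cong\mathsf{Comod}_{\mathfrak{C}}$. (v) ${}_B\mathfrak{a}$ is a pure submodule of ${}_BB$, $\mathfrak{a}^2=\mathfrak{a}$, and $\mathfrak{C}\mathfrak{a}=\mathfrak{C}$.
   Context: Rings are associative unital algebras over a commutative ring $K$. An $A$-coring is an $A$-bimodule $\mathfrak{C}$ with $A$-bimodule maps $\Delta:\mathfrak{C}\to\mathfrak{C}\otimes_A\mathfrak{C}$ (coassociative) and $\varepsilon:\mathfrak{C}\to A$ (counit). $\mathsf{Comod}_{\mathfrak{C}}$ is the category of right $\mathfrak{C}$-comodules, i.e. right $A$-modules $M$ with a coassociative, counital right $A$-linear map $M\to M\otimes_A\mathfrak{C}$. ${}^*\mathfrak{C}=\mathrm{Hom}({}_A\mathfrak{C},{}_AA)$ is the left dual convolution ring, with product $(f\cdot g)(c)=\sum f(c_{(1)}g(c_{(2)}))$ and unit $\varepsilon$. A right rational pairing over $A$ is a triple $\mathscr{T}=(\mathfrak{C},B,\langle-,-\rangle)$ with $\mathfrak{C}$ an $A$-coring, $B$ an $A$-ring (a ring with a ring homomorphism $A\to B$), and $\langle-,-\rangle:\mathfrak{C}\times B\to A$ a balanced $A$-bilinear form ($\langle ac,b\rangle=a\langle c,b\rangle$, $\langle c,ba\rangle=\langle c,b\rangle a$, $\langle ca,b\rangle=\langle c,ab\rangle$) such that: (1) $\beta_A:B\to{}^*\mathfrak{C}$, $b\mapsto[c\mapsto\langle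 c,b\rangle]$, is a ring anti-homomorphism; and (2) for each right $A$-module $M$ the map $\alpha_M:M\otimes_A\mathfrak{C}\to\mathrm{Hom}(B_A,M_A)$, $m\otimes_A c\mapsto[b\mapsto m\langle c,b\rangle]$, is injective. An element $m$ of a right $B$-module $M$ is rational if there is a finite set $\{(c_i,m_i)\}\subseteq\mathfrak{C}\times M$ (right rational parameters) with $mb=\sum_i m_i\langle c_i,b\rangle$ for all $b\in B$. The set $\mathrm{Rat}^{\mathscr{T}}(M)$ of rational elements is a $B$-submodule of $M$, and $\mathrm{Rat}^{\mathscr{T}}$ is a left exact preradical on $\mathsf{Mod}_B$. $\mathrm{Rat}^{\mathscr{T}}(\mathsf{Mod}_B)$ is the full subcategory of $\mathsf{Mod}_B$ of modules $M$ with $\mathrm{Rat}^{\mathscr{T}}(M)=M$; it is closed under submodules, quotients and direct sums, and is known to be isomorphic to $\mathsf{Comod}_{\mathfrak{C}}$, a right comodule $M$ being a right $B$-module by $mb=\sum m_{(0)}\langle m_{(1)},b\rangle$. In particular $\mathfrak{C}$ is a right $B$-module, $cb=\sum c_{(1)}\langle c_{(2)},b\rangle$. $\mathfrak{a}$ is a two-sided ideal of $B$. $\mathsf{Ker}(\mathrm{Rat}^{\mathscr{T}})$ is the full subcategory of $\mathsf{Mod}_B$ of modules $X$ with $\mathrm{Rat}^{\mathscr{T}}(X)=0$. A full subcategory $\mathcal{L}$ of $\mathsf{Mod}_B$ is localizing if it is stable under coproducts and, for every short exact sequence $0\to X\to Y\to Z\to0$, $Y\in\mathcal{L}$ iff $X,Z\in\mathcal{L}$;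 $\mathbf{T}:\mathsf{Mod}_B\to\mathsf{Mod}_B/\mathcal{L}$ denotes the canonical functor to Gabriel's quotient category. $\mathrm{Hom}_B(\mathfrak{a}_B,M)$ is a right $B$-module via $(fb)(x)=f(bx)$. If $\mathfrak{a}$ is an idempotent two-sided ideal of $B$ such that the left $B$-module $B/\mathfrak{a}$ is flat, the canonical isomorphism $\mathfrak{a}\cong\mathfrak{a}\otimes_B\mathfrak{a}$ makes $\mathfrak{a}$ a $B$-coring with counit the inclusion $\mathfrak{a}\subseteq B$; one then says that $\mathfrak{a}$ is a (left) idempotent $B$-coring. *)

(* Defs.v *)
From HB Require Import structures.
From mathcomp Require Import all_boot all_algebra.
From mathcomp Require Import boolp.

Set Implicit Arguments.
Unset Strict Implicit.
Unset Printing Implicit Defensive.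

Import GRing.Theory.
Local Open Scope ring_scope.
Local Open Scope quotient_scope.

Lemma linear_eq (R : pzRingType) (U V : lmodType R) (f g : {linear U -> V}) :
  f =1 g -> f = g.
Proof.
case: f g => f [[fD] [fZ]] [g [[gD] [gZ]]] /= /funext fg; subst g.
by rewrite (Prop_irrelevance fD gD) (Prop_irrelevance fZ gZ).
Qed.

Record submodule (R : pzRingType) (M : lmodType R) := Submodule {
  smem :> M -> Prop;
  smem0 : smem 0;
  smemP : forall a x y, smem x -> smem y -> smem (a *: x + y)
}.

Section Sub.
Variables (R : pzRingType) (M : lmodType R) (S : submodule M).

Definition smem_pred : {pred M} := fun x => `[< S x >].

Lemma smem_pred_closed : submod_closed smem_pred.
Proof.
split=> [|a x y Sx Sy]; rewrite unfold_in; apply/asboolP; first exact: smem0.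
by apply: smemP; apply/asboolP.
Qed.

HB.instance Definition _ :=
  GRing.isSubmodClosed.Build R M smem_pred smem_pred_closed.

Record sub_lmod := SubLmod { smval :> M; smval_mem : smval \in smem_pred }.

HB.instance Definition _ := [isSub for smval].
HB.instance Definition _ := [Choice of sub_lmod by <:].
HB.instance Definition _ := [SubChoice_isSubLmodule of sub_lmod by <:].

Lemma smvalP (x : sub_lmod) : S (smval x).
Proof. by apply/asboolP; exact: smval_mem. Qed.

Definition smem_sub x (Sx : S x) : sub_lmod := SubLmod (asboolT Sx).

Lemma smval_linear : linear smval. Proof. by []. Qed.
HB.instance Definition _ :=
  GRing.isLinear.Build R sub_lmod M _ smval smval_linear.

Lemma smval_inj : injective smval. Proof. exact: val_inj. Qed.

End Sub.
Section Quot.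
Variables (R : pzRingType) (M : lmodType R) (S : submodule M).

Lemma smemN x : S x -> S (- x).
Proof. by move=> Sx; rewrite -scaleN1r -[X in S X]addr0; apply: smemP (smem0 S). Qed.
Lemma smemD x y : S x -> S y -> S (x + y).
Proof. by move=> Sx; rewrite -[x]scale1r; apply: smemP. Qed.
Lemma smemZ a x : S x -> S (a *: x).
Proof. by move=> Sx; rewrite -[X in S X]addr0; apply: smemP (smem0 S). Qed.

Definition smod_eq : rel M := fun x y => `[< S (x - y) >].

Lemma smod_eq_equiv : equiv_class_of smod_eq.
Proof.
split=> [x|x y|y x z].
- by apply/asboolP; rewrite subrr; exact: smem0.
- by apply: asbool_equiv_eq; split=> /smemN; rewrite opprB.
- move=> /asboolP xy /asboolP yz; apply/asboolP.
  by rewrite -[x](subrK y) -addrA; apply: smemD.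
Qed.
Canonical smod_equiv := EquivRelPack smod_eq_equiv.

Definition quot_lmod := {eq_quot smod_eq}.
HB.instance Definition _ := Choice.on quot_lmod.
HB.instance Definition _ := EqQuotient.on quot_lmod.

Definition qcl (x : M) : quot_lmod := \pi x.

Lemma qclP x y : qcl x = qcl y <-> S (x - y).
Proof. by split=> [/eqmodP/asboolP|xy] //; apply/eqmodP/asboolP. Qed.

Lemma qclK (q : quot_lmod) : qcl (repr q) = q. Proof. exact: reprK. Qed.

Definition qzero := qcl 0.
Definition qadd (p q : quot_lmod) := qcl (repr p + repr q).
Definition qopp (p : quot_lmod) := qcl (- repr p).
Definition qscale a (p : quot_lmod) := qcl (a *: repr p).

Lemma qaddE x y : qadd (qcl x) (qcl y) = qcl (x + y).
Proof.
apply/qclP; rewrite opprD addrACA; apply: smemD; apply/qclP; exact: qclK.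
Qed.
Lemma qoppE x : qopp (qcl x) = qcl (- x).
Proof. by apply/qclP; rewrite -opprD; apply: smemN; apply/qclP; exact: qclK. Qed.
Lemma qscaleE a x : qscale a (qcl x) = qcl (a *: x).
Proof. by apply/qclP; rewrite -scalerBr; apply: smemZ; apply/qclP; exact: qclK. Qed.

Lemma qaddA : associative qadd.
Proof.
move=> p q r; rewrite -[p]qclK -[q]qclK -[r]qclK.
by rewrite !qaddE addrA.
Qed.
Lemma qaddC : commutative qadd.
Proof. by move=> p q; rewrite -[p]qclK -[q]qclK !qaddE addrC. Qed.
Lemma qadd0 : left_id qzero qadd.
Proof. by move=> p; rewrite -[p]qclK qaddE add0r. Qed.
Lemma qaddN : left_inverse qzero qopp qadd.
Proof. by move=> p; rewrite -[p]qclK qoppE qaddE addNr. Qed.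

HB.instance Definition _ :=
  GRing.isZmodule.Build quot_lmod qaddA qaddC qadd0 qaddN.

Lemma qscaleA a b p : qscale a (qscale b p) = qscale (a * b) p.
Proof. by rewrite -[p]qclK !qscaleE scalerA. Qed.
Lemma qscale1 : left_id 1 qscale.
Proof. by move=> p; rewrite -[p]qclK qscaleE scale1r. Qed.
Lemma qscaleDr : right_distributive qscale +%R.
Proof.
move=> a p q; rewrite -[p]qclK -[q]qclK.
by rewrite /+%R /= qaddE !qscaleE qaddE scalerDr.
Qed.
Lemma qscaleDl p : {morph qscale^~ p : a b / a + b}.
Proof.
by move=> a b /=; rewrite -[p]qclK !qscaleE [RHS]qaddE scalerDl.
Qed.
HB.instance Definition _ :=
  GRing.Zmodule_isLmodule.Build R quot_lmod qscaleA qscale1 qscaleDr qscaleDl.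

Lemma qcl_linear : linear qcl.
Proof. by move=> a x y; rewrite [LHS]/qcl; rewrite -[RHS]/(qadd (qscale _ _) _) qscaleE qaddE. Qed.
HB.instance Definition _ := GRing.isLinear.Build R M quot_lmod _ qcl qcl_linear.
Lemma qclL a x y : qcl (a *: x + y) = a *: qcl x + qcl y.
Proof. exact: linearP. Qed.
End Quot.

(* Right R-modules are modules over the converse ring, lmodType R^c. *)
Section RightScale.
Variables (R : pzRingType) (M : lmodType R^c).
Implicit Types (x y : M) (a b : R).

Definition rscale x a : M := (a : R^c) *: x.

Lemma rscaleA x a b : rscale (rscale x a) b = rscale x (a * b).
Proof. by rewrite /rscale scalerA. Qed.
Lemma rscale1 x : rscale x 1 = x. Proof. exact: scale1r. Qed.
Lemma rscaleDl x y a : rscale (x + y) a = rscale x a + rscale y a.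
Proof. exact: scalerDr. Qed.
Lemma rscaleDr x a b : rscale x (a + b) = rscale x a + rscale x b.
Proof. exact: scalerDl. Qed.
Lemma rscale0l a : rscale 0 a = 0. Proof. exact: scaler0. Qed.
Lemma rscale0r x : rscale x 0 = 0. Proof. exact: scale0r. Qed.
Lemma rscale_suml I (s : seq I) (F : I -> M) a :
  rscale (\sum_(i <- s) F i) a = \sum_(i <- s) rscale (F i) a.
Proof. exact: scaler_sumr. Qed.
End RightScale.

Notation "x :* a" := (rscale x a) : ring_scope.

Lemma linear_rscale (R : pzRingType) (M N : lmodType R^c)
  (f : {linear M -> N}) x a : f (x :* a) = f x :* a.
Proof. exact: linearZ. Qed.

Section Tensor.
Variables (R : pzRingType) (M : lmodType R^c) (N : lmodType R).

(* M ⊗_R N as formal sums of pairs, modulo the congruence generated by *)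
(* commutativity, biadditivity and balancedness; (0, n) ~ 0 has to be added *)
(* since lists only form a monoid. *)
Inductive tens_rel : seq (M * N) -> seq (M * N) -> Prop :=
| tens_refl s : tens_rel s s
| tens_sym s t : tens_rel s t -> tens_rel t s
| tens_trans s t u : tens_rel s t -> tens_rel t u -> tens_rel s u
| tens_cat s s' t t' :
    tens_rel s s' -> tens_rel t t' -> tens_rel (s ++ t) (s' ++ t')
| tens_swap s t : tens_rel (s ++ t) (t ++ s)
| tens_addl m m' n : tens_rel [:: (m + m', n)] [:: (m, n); (m', n)]
| tens_addr m n n' : tens_rel [:: (m, n + n')] [:: (m, n); (m, n')]
| tens_zero n : tens_rel [:: (0, n)] [::]
| tens_bal m a n : tens_rel [:: (m :* a, n)] [:: (m, a *: n)].

Definition tens_eq : rel (seq (M * N)) := fun s t => `[< tens_rel s t >].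

Lemma tens_eq_equiv : equiv_class_of tens_eq.
Proof.
split=> [s|s t|t s u].
- by apply/asboolP; exact: tens_refl.
- by apply: asbool_equiv_eq; split; exact: tens_sym.
- by move=> /asboolP st /asboolP tu; apply/asboolP; exact: tens_trans tu.
Qed.
Canonical tens_equiv := EquivRelPack tens_eq_equiv.

Definition tensor := {eq_quot tens_eq}.
HB.instance Definition _ := Choice.on tensor.
HB.instance Definition _ := EqQuotient.on tensor.

Definition tcl (s : seq (M * N)) : tensor := \pi s.
Definition tpure (m : M) (n : N) : tensor := tcl [:: (m, n)].

Lemma tclP s t : tcl s = tcl t <-> tens_rel s t.
Proof. by split=> [/eqmodP/asboolP|st] //; apply/eqmodP/asboolP. Qed.
Lemma tclK (t : tensor) : tcl (repr t) = t. Proof. exact: reprK. Qed.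

Definition tadd (t u : tensor) := tcl (repr t ++ repr u).
Definition topp (t : tensor) := tcl [seq (- p.1, p.2) | p <- repr t].

Lemma taddE s t : tadd (tcl s) (tcl t) = tcl (s ++ t).
Proof. by apply/tclP/tens_cat; apply/tclP; exact: tclK. Qed.

Lemma tens_opp s t : tens_rel s t ->
  tens_rel [seq (- p.1, p.2) | p <- s] [seq (- p.1, p.2) | p <- t].
Proof.
elim=> /= {s t}.
- by move=> s; exact: tens_refl.
- by move=> s t _; exact: tens_sym.
- by move=> s t u _ st _ tu; exact: tens_trans tu.
- by move=> s s' t t' _ ss' _ tt'; rewrite !map_cat; exact: tens_cat.
- by move=> s t; rewrite !map_cat; exact: tens_swap.
- by move=> m m' n; rewrite opprD; exact: tens_addl.
- by move=> m n n'; exact: tens_addr.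
- by move=> n; rewrite oppr0; exact: tens_zero.
- by move=> m a n; rewrite /rscale -scalerN; exact: tens_bal.
Qed.

Lemma toppE s : topp (tcl s) = tcl [seq (- p.1, p.2) | p <- s].
Proof. by apply/tclP/tens_opp; apply/tclP; exact: tclK. Qed.

Lemma taddA : associative tadd.
Proof. by move=> t u v; rewrite -[t]tclK -[u]tclK -[v]tclK !taddE catA. Qed.
Lemma taddC : commutative tadd.
Proof.
by move=> t u; rewrite -[t]tclK -[u]tclK !taddE; apply/tclP; exact: tens_swap.
Qed.
Lemma tadd0 : left_id (tcl [::]) tadd.
Proof. by move=> t; rewrite -[t]tclK taddE. Qed.
Lemma taddN : left_inverse (tcl [::]) topp tadd.
Proof.
move=> t; rewrite -[t]tclK; elim: (repr t) => [|[m n] s IH].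
  by rewrite toppE taddE.
rewrite -[_ :: s]cat1s -taddE.
have -> : topp (tadd (tcl [:: (m, n)]) (tcl s)) =
  tadd (topp (tcl s)) (topp (tcl [:: (m, n)])).
  by rewrite taddC taddE !toppE taddE map_cat.
rewrite -taddA [X in tadd _ X]taddA.
suff -> : tadd (topp (tcl [:: (m, n)])) (tcl [:: (m, n)]) = tcl [::].
  by rewrite tadd0.
rewrite toppE taddE; apply/tclP; apply: tens_trans (tens_zero n).
by rewrite -(addNr m); apply: tens_sym; exact: tens_addl.
Qed.

HB.instance Definition _ :=
  GRing.isZmodule.Build tensor taddA taddC tadd0 taddN.

Lemma tpureDl m m' n : tpure (m + m') n = tpure m n + tpure m' n.
Proof. by rewrite [RHS]taddE; apply/tclP; exact: tens_addl. Qed.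
Lemma tpureDr m n n' : tpure m (n + n') = tpure m n + tpure m n'.
Proof. by rewrite [RHS]taddE; apply/tclP; exact: tens_addr. Qed.
Lemma tpure_bal m a n : tpure (m :* a) n = tpure m (a *: n).
Proof. by apply/tclP; exact: tens_bal. Qed.

Lemma tclE s : tcl s = \sum_(p <- s) tpure p.1 p.2.
Proof.
elim: s => [|[m n] s IH]; first by rewrite big_nil.
by rewrite big_cons -IH [RHS]taddE.
Qed.

Lemma tens_sumP (t : tensor) : exists s, t = \sum_(p <- s) tpure p.1 p.2.
Proof. by exists (repr t); rewrite -tclE tclK. Qed.

Definition balanced (G : zmodType) (f : M -> N -> G) : Prop :=
  [/\ forall m m' n, f (m + m') n = f m n + f m' n,
      forall m n n', f m (n + n') = f m n + f m n'
    & forall m a n, f (m :* a) n = f m (a *: n)].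

(* The additive map M ⊗ N -> G induced by a balanced f (see tsum_pure and *)
(* tsumD); it depends on the choice of representatives when f is *)
(* not balanced. *)
Definition tsum (G : zmodType) (f : M -> N -> G) (t : tensor) : G :=
  \sum_(p <- repr t) f p.1 p.2.

Section Lift.
Variables (G : zmodType) (f : M -> N -> G).
Hypothesis bf : balanced f.

Lemma tsum_cl s : tsum f (tcl s) = \sum_(p <- s) f p.1 p.2.
Proof.
have [fDl fDr fZ] := bf.
rewrite /tsum; have /tclP := tclK (tcl s); move: (repr _) => r.
elim=> {s r} //=.
- by move=> s t u _ -> _ ->.
- by move=> s s' t t' _ IHs _ IHt; rewrite !big_cat /= IHs IHt.
- by move=> s t; rewrite !big_cat /= addrC.
- by move=> m m' n; rewrite !big_cons !big_nil /= !addr0 fDl.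
- by move=> m n n'; rewrite !big_cons !big_nil /= !addr0 fDr.
- move=> n; rewrite !big_cons !big_nil /= addr0.
  by apply: (addrI (f 0 n)); rewrite -fDl !addr0.
- by move=> m a n; rewrite !big_cons !big_nil /= !addr0 fZ.
Qed.

Lemma tsum_pure m n : tsum f (tpure m n) = f m n.
Proof. by rewrite tsum_cl big_seq1. Qed.

Lemma tsumD t u : tsum f (t + u) = tsum f t + tsum f u.
Proof.
by rewrite -[t]tclK -[u]tclK [X in tsum f X]taddE !tsum_cl big_cat.
Qed.
Lemma tsum0 : tsum f 0 = 0. Proof. by rewrite [tsum _ _]tsum_cl big_nil. Qed.
Lemma tsum_sum I (s : seq I) F :
  tsum f (\sum_(i <- s) F i) = \sum_(i <- s) tsum f (F i).
Proof. exact: (big_morph _ tsumD tsum0). Qed.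
End Lift.

Lemma tens_ext (G : zmodType) (h k : tensor -> G) :
  {morph h : t u / t + u} -> {morph k : t u / t + u} ->
  (forall m n, h (tpure m n) = k (tpure m n)) -> h =1 k.
Proof.
have morph0 (g : tensor -> G) : {morph g : t u / t + u} -> g 0 = 0.
  by move=> gD; apply: (addrI (g 0)); rewrite -gD !addr0.
move=> hD kD hk t; have [s ->] := tens_sumP t.
rewrite (big_morph h hD (morph0 _ hD)) (big_morph k kD (morph0 _ kD)).
by apply: eq_bigr => p _.
Qed.

Lemma tpure_balanced : balanced tpure.
Proof. by split; [exact: tpureDl | exact: tpureDr | exact: tpure_bal]. Qed.

Lemma tpure0l n : tpure 0 n = 0.
Proof. by apply: (addrI (tpure 0 n)); rewrite -tpureDl !addr0. Qed.
Lemma tpure0r m : tpure m 0 = 0.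
Proof. by apply: (addrI (tpure m 0)); rewrite -tpureDr !addr0. Qed.

End Tensor.

Notation "m ⊗ n" := (tpure m n) (at level 40, left associativity) : ring_scope.

Section TensorMap.
Variables (R : pzRingType) (M M' : lmodType R^c) (N N' : lmodType R).

(* The map f ⊗ g, meaningful for linear f and g (see tmap_pure). *)
Definition tmap (f : M -> M') (g : N -> N') (t : tensor M N) : tensor M' N' :=
  tsum (fun m n => f m ⊗ g n) t.

Variables (f : {linear M -> M'}) (g : {linear N -> N'}).

Lemma tmap_balanced : balanced (fun m n => f m ⊗ g n).
Proof.
split=> [m m' n|m n n'|m a n]; rewrite ?raddfD ?tpureDl ?tpureDr //.
by rewrite linear_rscale tpure_bal linearZ.
Qed.
Lemma tmap_pure m n : tmap f g (m ⊗ n) = f m ⊗ g n.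
Proof. exact: (tsum_pure tmap_balanced). Qed.
Lemma tmapD t u : tmap f g (t + u) = tmap f g t + tmap f g u.
Proof. exact: (tsumD tmap_balanced). Qed.
End TensorMap.

Lemma tmap_comp (R : pzRingType) (M M' M'' : lmodType R^c)
    (N N' N'' : lmodType R) (f : {linear M -> M'}) (f' : {linear M' -> M''})
    (g : {linear N -> N'}) (g' : {linear N' -> N''}) t :
  tmap (f' \o f) (g' \o g) t = tmap f' g' (tmap f g t).
Proof.
move: t; apply: tens_ext => [t u|t u|m n].
- exact: (tmapD [the {linear _ -> _} of f' \o f] [the {linear _ -> _} of g' \o g]).
- by rewrite !tmapD.
- rewrite (tmap_pure [the {linear _ -> _} of f' \o f] [the {linear _ -> _} of g' \o g]).
  by rewrite !tmap_pure.
Qed.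

Lemma tmap_id (R : pzRingType) (M : lmodType R^c) (N : lmodType R)
    (t : tensor M N) : tmap idfun idfun t = t.
Proof.
move: t; apply: tens_ext => // [t u|m n].
- exact: (tmapD [the {linear M -> M} of idfun] [the {linear N -> N} of idfun]).
- exact: (tmap_pure [the {linear M -> M} of idfun] [the {linear N -> N} of idfun]).
Qed.

(* An (R, R)-bimodule is a right R-module, i.e. an R^c-module, with a *)
(* compatible left action. *)
Record bimodule (R : pzRingType) := Bimodule {
  bim_right :> lmodType R^c;
  lscale : R -> bim_right -> bim_right;
  lscaleA : forall a b x, lscale a (lscale b x) = lscale (a * b) x;
  lscale1 : forall x, lscale 1 x = x;
  lscaleDr : forall a x y, lscale a (x + y) = lscale a x + lscale a y;
  lscaleDl : forall a b x, lscale (a + b) x = lscale a x + lscale b x;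
  lscale_rscale : forall a x b, lscale a (x :* b) = lscale a x :* b
}.

Definition bim_left (R : pzRingType) (P : bimodule R) : Type := bim_right P.

Section BimLeft.
Variables (R : pzRingType) (P : bimodule R).
HB.instance Definition _ := GRing.Zmodule.on (bim_left P).
HB.instance Definition _ := GRing.Zmodule_isLmodule.Build R (bim_left P)
  (@lscaleA R P) (@lscale1 R P) (@lscaleDr R P)
  (fun x a b => @lscaleDl R P a b x).
End BimLeft.

(* M ⊗_R P as a right module, for a bimodule P. *)
Definition tens_right (R : pzRingType) (M : lmodType R^c) (P : bimodule R) :
  Type := tensor M (bim_left P).

Section TensRight.
Variables (R : pzRingType) (M : lmodType R^c) (P : bimodule R).
HB.instance Definition _ := GRing.Zmodule.on (tens_right M P).

Definition tens_rscale (a : R^c) (t : tens_right M P) : tens_right M P :=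
  tsum (fun (m : M) (p : bim_left P) => m ⊗ ((p : P) :* a : bim_left P)) t.

Lemma tens_rscale_balanced (a : R^c) :
  balanced (fun (m : M) (p : bim_left P) => m ⊗ ((p : P) :* a : bim_left P)).
Proof.
split=> [m m' n|m n n'|m b n]; rewrite ?tpureDl //.
  by rewrite -tpureDr; congr tpure; exact: rscaleDl.
by rewrite tpure_bal; congr tpure; exact: lscale_rscale.
Qed.

Lemma tens_rscale_pure a m (p : bim_left P) :
  tens_rscale a (m ⊗ p) = m ⊗ ((p : P) :* a : bim_left P).
Proof. exact: (tsum_pure (tens_rscale_balanced a)). Qed.

Lemma tens_rscaleDr : right_distributive tens_rscale +%R.
Proof. by move=> a t u; exact: (tsumD (tens_rscale_balanced a)). Qed.

Lemma tens_rscaleA a b t :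
  tens_rscale a (tens_rscale b t) = tens_rscale (a * b) t.
Proof.
move: t; apply: tens_ext => [t u|t u|m p]; rewrite ?tens_rscaleDr //.
by rewrite !tens_rscale_pure; congr tpure; exact: rscaleA.
Qed.
Lemma tens_rscale1 : left_id 1 tens_rscale.
Proof.
apply: tens_ext => [t u|t u|m p]; rewrite ?tens_rscaleDr //.
by rewrite tens_rscale_pure; congr tpure; exact: rscale1.
Qed.
Lemma tens_rscaleDl t : {morph tens_rscale^~ t : a b / a + b}.
Proof.
move=> a b /=; move: t; apply: tens_ext => [t u|t u|m p]; rewrite ?tens_rscaleDr //.
  by rewrite addrACA.
rewrite !tens_rscale_pure -tpureDr; congr tpure; exact: rscaleDr.
Qed.

HB.instance Definition _ := GRing.Zmodule_isLmodule.Build R^c (tens_right M P)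
  tens_rscaleA tens_rscale1 tens_rscaleDr tens_rscaleDl.

Lemma tens_right_pure m (p : bim_left P) a :
  (m ⊗ p : tens_right M P) :* a = (m ⊗ ((p : P) :* a : bim_left P) : tens_right M P).
Proof. exact: tens_rscale_pure. Qed.
End TensRight.

(* P ⊗_R Q as a bimodule. *)
Section TensBim.
Variables (R : pzRingType) (P Q : bimodule R).

Definition tens_lscale (a : R) (t : tens_right P Q) : tens_right P Q :=
  tsum (fun (p : P) (q : bim_left Q) => lscale a p ⊗ q) t.

Lemma tens_lscale_balanced (a : R) :
  balanced (fun (p : P) (q : bim_left Q) => lscale a p ⊗ q).
Proof.
split=> [m m' n|m n n'|m b n]; rewrite ?tpureDr //.
  by rewrite -tpureDl lscaleDr.
by rewrite lscale_rscale tpure_bal.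
Qed.
Lemma tens_lscale_pure a p (q : bim_left Q) :
  tens_lscale a (p ⊗ q) = lscale a p ⊗ q.
Proof. exact: (tsum_pure (tens_lscale_balanced a)). Qed.
Lemma tens_lscaleDr a t u :
  tens_lscale a (t + u) = tens_lscale a t + tens_lscale a u.
Proof. exact: (tsumD (tens_lscale_balanced a)). Qed.
Lemma tens_lscaleA a b t :
  tens_lscale a (tens_lscale b t) = tens_lscale (a * b) t.
Proof.
move: t; apply: tens_ext => [t u|t u|m p]; rewrite ?tens_lscaleDr //.
by rewrite !tens_lscale_pure lscaleA.
Qed.
Lemma tens_lscale1 t : tens_lscale 1 t = t.
Proof.
move: t; apply: tens_ext => [t u|t u|m p]; rewrite ?tens_lscaleDr //.
by rewrite tens_lscale_pure lscale1.
Qed.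
Lemma tens_lscaleDl a b t :
  tens_lscale (a + b) t = tens_lscale a t + tens_lscale b t.
Proof.
move: t; apply: tens_ext => [t u|t u|m p]; rewrite ?tens_lscaleDr //.
  by rewrite addrACA.
by rewrite !tens_lscale_pure lscaleDl tpureDl.
Qed.
Lemma tens_lscale_rscale a t b :
  tens_lscale a (t :* b) = tens_lscale a t :* b.
Proof.
move: t; apply: tens_ext => [t u|t u|m p].
- by rewrite (rscaleDl (t : tens_right P Q)) tens_lscaleDr.
- by rewrite tens_lscaleDr (rscaleDl (_ : tens_right P Q)).
by rewrite (tens_right_pure (m : P)) !tens_lscale_pure (tens_right_pure (_ : P)).
Qed.

Definition tens_bim : bimodule R := @Bimodule R (tens_right P Q)
  tens_lscale tens_lscaleA tens_lscale1 tens_lscaleDr tens_lscaleDl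
  tens_lscale_rscale.
End TensBim.

(* The canonical isomorphism (M ⊗ P) ⊗ Q -> M ⊗ (P ⊗ Q). *)
Definition tassoc (R : pzRingType) (M : lmodType R^c) (P Q : bimodule R)
    (t : tens_right (tens_right M P) Q) : tensor M (bim_left (tens_bim P Q)) :=
  tsum (fun (u : tens_right M P) (q : bim_left Q) =>
    tsum (fun (m : M) (p : bim_left P) =>
      m ⊗ ((p : P) ⊗ q : bim_left (tens_bim P Q))) u) t.

Section TAssoc.
Variables (R : pzRingType) (M : lmodType R^c) (P Q : bimodule R).

Lemma tassoc_inner_balanced (q : bim_left Q) :
  balanced (fun (m : M) (p : bim_left P) =>
    m ⊗ ((p : P) ⊗ q : bim_left (tens_bim P Q))).
Proof.
split=> [m m' p|m p p'|m a p]; rewrite ?tpureDl //.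
  by rewrite -tpureDr; congr tpure; exact: (tpureDl (p : P) (p' : P)).
by rewrite tpure_bal; congr tpure; exact: (tens_lscale_pure a (p : P)).
Qed.

Lemma tassoc_balanced :
  balanced (fun (u : tens_right M P) (q : bim_left Q) =>
    tsum (fun (m : M) (p : bim_left P) =>
      m ⊗ ((p : P) ⊗ q : bim_left (tens_bim P Q))) u).
Proof.
split=> [u u' q|u q q'|u a q].
- exact: (tsumD (tassoc_inner_balanced q)).
- move: u; apply: tens_ext => [t u|t u|m p].
  + exact: (tsumD (tassoc_inner_balanced (q + q'))).
  + by rewrite !(tsumD (tassoc_inner_balanced _)) addrACA.
  rewrite !(tsum_pure (tassoc_inner_balanced _)) -tpureDr; congr tpure.
  exact: (tpureDr (p : P)).
- move: u; apply: tens_ext => [t u|t u|m p].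
  + by rewrite (rscaleDl (t : tens_right M P)) !(tsumD (tassoc_inner_balanced _)).
  + by rewrite !(tsumD (tassoc_inner_balanced _)).
  rewrite tens_right_pure !(tsum_pure (tassoc_inner_balanced _)).
  by congr tpure; exact: (tpure_bal (p : P)).
Qed.

Lemma tassocD t u : tassoc (t + u) = tassoc t + tassoc u :> tensor M (bim_left (tens_bim P Q)).
Proof. exact: (tsumD tassoc_balanced). Qed.

Lemma tassoc_pure (m : M) (p : bim_left P) (q : bim_left Q) :
  tassoc ((m ⊗ p : tens_right M P) ⊗ q) =
    m ⊗ ((p : P) ⊗ q : bim_left (tens_bim P Q)).
Proof.
by rewrite /tassoc (tsum_pure tassoc_balanced) (tsum_pure (tassoc_inner_balanced _)).
Qed.
End TAssoc.

Lemma tmap_rscale (R : pzRingType) (M N : lmodType R^c) (P : bimodule R)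
    (f : {linear M -> N}) (t : tens_right M P) a :
  tmap f idfun (t :* a) = (tmap f idfun t : tens_right N P) :* a.
Proof.
move: t; apply: tens_ext => [t u|t u|m p].
- by rewrite (rscaleDl (t : tens_right M P)) tmapD.
- by rewrite tmapD (rscaleDl (_ : tens_right N P)).
- by rewrite tens_right_pure !tmap_pure tens_right_pure.
Qed.

Section TensRightExact.
Variables (R : pzRingType) (M : lmodType R^c) (S : submodule M) (P : bimodule R).

Let im (t : tens_right M P) := exists u : tensor (sub_lmod S) (bim_left P),
  t = tmap (@smval _ _ S) idfun u.

Let im0 : im 0.
Proof. by exists 0; rewrite /tmap tsum0 //; exact: tmap_balanced. Qed.

Let imP a x y : im x -> im y -> im (a *: x + y).
Proof.
move=> [u ->] [v ->]; exists (a *: (u : tens_right (sub_lmod S) P) + v).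
rewrite tmapD; congr (_ + _).
exact: esym (tmap_rscale (smval (S:=S)) (u : tens_right (sub_lmod S) P) a).
Qed.

Lemma tens_right_exact (t : tensor M (bim_left P)) :
  tmap (qcl S) idfun t = 0 ->
  exists u : tensor (sub_lmod S) (bim_left P), t = tmap (@smval _ _ S) idfun u.
Proof.
pose I := Submodule im0 imP.
pose g (q : quot_lmod S) (p : bim_left P) : quot_lmod I :=
  qcl I (repr q ⊗ p : tens_right M P).
have gE m p : g (qcl S m) p = qcl I (m ⊗ p : tens_right M P).
  apply/qclP; have /qclP Sx : qcl S (repr (qcl S m)) = qcl S m by exact: qclK.
  exists (smem_sub Sx ⊗ p); rewrite tmap_pure.
  by apply/eqP; rewrite subr_eq -tpureDl subrK.
have bg : balanced g.
  split=> [q q' p|q p p'|q a p].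
  - by rewrite -[q]qclK -[q']qclK -raddfD !gE -raddfD tpureDl.
  - by rewrite -[q]qclK !gE -raddfD tpureDr.
  - rewrite -[q]qclK -(linear_rscale (qcl S)) !gE; congr (qcl I _).
    exact: tpure_bal.
have key : forall t, tsum g (tmap (qcl S) idfun t) = qcl I (t : tens_right M P).
  apply: tens_ext => [x y|x y|m p].
  - by rewrite tmapD tsumD.
  - exact: raddfD.
  - by rewrite tmap_pure (tsum_pure bg) gE.
move=> t0; have := key t; rewrite t0 tsum0 // => /esym /(qclP I (_ : tens_right M P) 0).
by rewrite subr0.
Qed.
End TensRightExact.

Record category := Category {
  ob :> Type;
  hom : ob -> ob -> Type;
  idm : forall X, hom X X;
  cmp : forall X Y Z, hom Y Z -> hom X Y -> hom X Z;
  cmpA : forall X Y Z W (h : hom Z W) (g : hom Y Z) (f : hom X Y),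
    cmp h (cmp g f) = cmp (cmp h g) f;
  cmp1m : forall X Y (f : hom X Y), cmp (idm Y) f = f;
  cmpm1 : forall X Y (f : hom X Y), cmp f (idm X) = f
}.

Record functor (C D : category) := Functor {
  fobj :> C -> D;
  fmap : forall X Y, hom X Y -> hom (fobj X) (fobj Y);
  fmap1 : forall X, fmap (idm X) = idm (fobj X);
  fmapM : forall X Y Z (g : hom Y Z) (f : hom X Y),
    fmap (cmp g f) = cmp (fmap g) (fmap f)
}.

Definition is_iso (C : category) (X Y : C) (f : hom X Y) : Prop :=
  exists g : hom Y X, cmp g f = idm X /\ cmp f g = idm Y.

Section Functors.
Variables (C D E : category).

Definition id_functor : functor C C :=
  @Functor C C id (fun X Y f => f) (fun X => erefl) (fun X Y Z g f => erefl).

Lemma comp_functor1 (G : functor D E) (F : functor C D) X :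
  fmap G (fmap F (idm X)) = idm (G (F X)).
Proof. by rewrite !fmap1. Qed.
Lemma comp_functorM (G : functor D E) (F : functor C D) X Y Z
    (g : hom Y Z) (f : hom X Y) :
  fmap G (fmap F (cmp g f)) = cmp (fmap G (fmap F g)) (fmap G (fmap F f)).
Proof. by rewrite !fmapM. Qed.
Definition comp_functor (G : functor D E) (F : functor C D) : functor C E :=
  @Functor C E (fun X => G (F X)) (fun X Y f => fmap G (fmap F f))
    (comp_functor1 G F) (@comp_functorM G F).

Definition nat_iso (F G : functor C D) : Prop :=
  exists2 a : forall X, hom (F X) (G X),
    forall X Y (f : hom X Y), cmp (a Y) (fmap F f) = cmp (fmap G f) (a X) &
    forall X, is_iso (a X).

Definition adjoint (F : functor C D) (G : functor D C) : Prop :=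
  exists phi : forall X Y, hom (F X) Y -> hom X (G Y),
    (forall X Y, bijective (@phi X Y)) /\
    (forall X X' Y Y' (f : hom X' X) (g : hom Y Y') (h : hom (F X) Y),
       phi X' Y' (cmp g (cmp h (fmap F f))) = cmp (fmap G g) (cmp (phi X Y h) f)).

Definition iso_of_categories (F : functor C D) : Prop :=
  bijective F /\ forall X Y, bijective (@fmap C D F X Y).

Definition is_coproduct (I : Type) (X : I -> C) (Y : C)
    (inj : forall i, hom (X i) Y) : Prop :=
  forall (Z : C) (f : forall i, hom (X i) Z),
    exists! h : hom Y Z, forall i, cmp h (inj i) = f i.

End Functors.

Definition equivalence (C D : category) (F : functor C D) : Prop :=
  exists G : functor D C,
    nat_iso (comp_functor G F) (id_functor C) /\
    nat_iso (comp_functor F G) (id_functor D).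

Section FullSubcategory.
Variables (C : category) (P : C -> Prop).

Record full_ob := FullOb { full_val :> C; full_valP : P full_val }.

Definition full_subcat : category := @Category full_ob
  (fun X Y => @hom C X Y) (fun X => @idm C X) (fun X Y Z => @cmp C X Y Z)
  (fun X Y Z W => @cmpA C X Y Z W) (fun X Y => @cmp1m C X Y)
  (fun X Y => @cmpm1 C X Y).

Definition full_incl : functor full_subcat C := @Functor full_subcat C
  full_val (fun X Y f => f) (fun X => erefl) (fun X Y Z g f => erefl).
End FullSubcategory.

Section ModCat.
Variable R : pzRingType.

Definition lmod_id (X : lmodType R) : {linear X -> X} := idfun.
Definition lmod_comp (X Y Z : lmodType R) (g : {linear Y -> Z})
  (f : {linear X -> Y}) : {linear X -> Z} := g \o f.

Lemma lmod_compA (X Y Z W : lmodType R) (h : {linear Z -> W}) (g : {linear Y -> Z})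
  (f : {linear X -> Y}) :
  lmod_comp h (lmod_comp g f) = lmod_comp (lmod_comp h g) f.
Proof. exact: linear_eq. Qed.
Lemma lmod_comp1m (X Y : lmodType R) (f : {linear X -> Y}) : lmod_comp (lmod_id Y) f = f.
Proof. exact: linear_eq. Qed.
Lemma lmod_compm1 (X Y : lmodType R) (f : {linear X -> Y}) : lmod_comp f (lmod_id X) = f.
Proof. exact: linear_eq. Qed.

Definition lmod_cat : category := @Category (lmodType R)
  (fun X Y => {linear X -> Y}) lmod_id lmod_comp lmod_compA lmod_comp1m
  lmod_compm1.

Definition short_exact (X Y Z : lmodType R) (f : {linear X -> Y})
    (g : {linear Y -> Z}) : Prop :=
  [/\ injective f, forall y, g y = 0 <-> exists x, y = f x
    & forall z, exists y, z = g y].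

End ModCat.

(* Mod_R, the category of right R-modules. *)
Definition Mod (R : pzRingType) : category := lmod_cat R^c.

Definition exact_functor (R S : pzRingType) (F : functor (Mod R) (Mod S)) :=
  forall (X Y Z : lmodType R^c) (f : {linear X -> Y}) (g : {linear Y -> Z}),
    short_exact f g -> short_exact (fmap F f : {linear _ -> _}) (fmap F g).

(* Comultiplication and counit of an R-coring with underlying bimodule P. *)
Record coring (R : pzRingType) (P : bimodule R) := Coring {
  delta : {linear P -> tens_right P P};
  counit : {linear P -> R^c^o};
  delta_lscale : forall a c, delta (lscale a c) = tens_lscale a (delta c);
  counit_lscale : forall a c, counit (lscale a c) = (a * (counit c : R))%R;
  deltaA : forall c, tassoc (tmap delta idfun (delta c)) =
    tmap idfun (delta : bim_left P -> bim_left (tens_bim P P)) (delta c);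
  counitl : forall c,
    tsum (fun (x : P) (y : bim_left P) => @lscale R P (counit x) y) (delta c) = c;
  counitr : forall c,
    tsum (fun (x : P) (y : bim_left P) => x :* counit y) (delta c) = c
}.

Section Comodules.
Variables (R : pzRingType) (P : bimodule R) (D : coring P).

Record comodule := Comodule {
  cm_right :> lmodType R^c;
  coact : {linear cm_right -> tens_right cm_right P};
  coactA : forall m, tassoc (tmap coact idfun (coact m)) =
    tmap idfun (delta D : bim_left P -> bim_left (tens_bim P P)) (coact m);
  coact1 : forall m,
    tsum (fun (x : cm_right) (c : bim_left P) => x :* counit D c) (coact m) = m
}.

Record comod_hom (M N : comodule) := ComodHom {
  cm_map :> {linear M -> N};
  cm_mapP : forall m, coact N (cm_map m) = tmap cm_map idfun (coact M m)
}.

Lemma comod_hom_eq M N (f g : comod_hom M N) : f =1 g -> f = g.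
Proof.
case: f g => f fP [g gP] /= /linear_eq fg; subst g.
by rewrite (Prop_irrelevance fP gP).
Qed.

Lemma comod_id_subproof (M : comodule) m :
  coact M (lmod_id M m) = tmap (lmod_id M) idfun (coact M m).
Proof. by rewrite [RHS]tmap_id. Qed.
Definition comod_id (M : comodule) := ComodHom (@comod_id_subproof M).

Lemma comod_comp_subproof (M N Q : comodule) (g : comod_hom N Q)
    (f : comod_hom M N) m :
  coact Q (lmod_comp g f m) = tmap (lmod_comp g f) idfun (coact M m).
Proof.
rewrite /= !cm_mapP.
exact: esym (tmap_comp f g (lmod_id (bim_left P)) (lmod_id (bim_left P)) _).
Qed.
Definition comod_comp M N Q (g : comod_hom N Q) (f : comod_hom M N) :=
  ComodHom (comod_comp_subproof g f).

Lemma comod_compA (M N Q S : comodule) (h : comod_hom Q S) (g : comod_hom N Q)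
  (f : comod_hom M N) : comod_comp h (comod_comp g f) = comod_comp (comod_comp h g) f.
Proof. exact: comod_hom_eq. Qed.
Lemma comod_comp1m (M N : comodule) (f : comod_hom M N) : comod_comp (comod_id N) f = f.
Proof. exact: comod_hom_eq. Qed.
Lemma comod_compm1 (M N : comodule) (f : comod_hom M N) : comod_comp f (comod_id M) = f.
Proof. exact: comod_hom_eq. Qed.

Definition Comod : category := @Category comodule comod_hom comod_id comod_comp
  comod_compA comod_comp1m comod_compm1.

Definition comod_forget : functor Comod (Mod R) := @Functor Comod (Mod R)
  cm_right (fun M N f => cm_map f) (fun M => erefl) (fun M N Q g f => erefl).

End Comodules.

(* A right S-module as a right R-module, by restriction along R -> S. *)
Definition restrict (R S : pzRingType) (i : {rmorphism R -> S})
  (M : lmodType S^c) : Type := M.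

Section Restrict.
Variables (R S : pzRingType) (i : {rmorphism R -> S}) (M : lmodType S^c).

HB.instance Definition _ := GRing.Zmodule.on (restrict i M).

Definition restrict_scale (a : R^c) (m : restrict i M) : restrict i M :=
  (m : M) :* i a.
Lemma restrict_scaleA a b m :
  restrict_scale a (restrict_scale b m) = restrict_scale (a * b) m.
Proof. by rewrite /restrict_scale rscaleA rmorphM. Qed.
Lemma restrict_scale1 : left_id 1 restrict_scale.
Proof. by move=> m; rewrite /restrict_scale rmorph1 rscale1. Qed.
Lemma restrict_scaleDr : right_distributive restrict_scale +%R.
Proof. by move=> a m n; exact: (rscaleDl (m : M)). Qed.
Lemma restrict_scaleDl m : {morph restrict_scale^~ m : a b / a + b}.
Proof.
by move=> a b; rewrite /restrict_scale rmorphD; exact: (rscaleDr (m : M)).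
Qed.
HB.instance Definition _ := GRing.Zmodule_isLmodule.Build R^c (restrict i M)
  restrict_scaleA restrict_scale1 restrict_scaleDr restrict_scaleDl.
End Restrict.

Section Pairing.
Variables (A B : pzRingType) (iota : {rmorphism A -> B}).
Variables (C : bimodule A) (D : coring C).

(* m ⊗ c |-> [b |-> m <c, b>] *)
Definition alpha (pair : C -> B -> A) (M : lmodType A^c)
    (t : tensor M (bim_left C)) (b : B) : M :=
  tsum (fun (m : M) (c : bim_left C) => m :* pair c b) t.

(* The product of the left dual ring of C, (f . g)(c) = sum f(c_1 g(c_2)). *)
Definition ldual_mul (f g : C -> A) (c : C) : A :=
  tsum (fun (x : C) (y : bim_left C) => f (x :* g y)) (delta D c).

Record rational_pairing := RationalPairing {
  pair :> C -> B -> A;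
  pairDl : forall c c' b, pair (c + c') b = pair c b + pair c' b;
  pairDr : forall c b b', pair c (b + b') = pair c b + pair c b';
  pair_lscale : forall a c b, pair (lscale a c) b = a * pair c b;
  pair_mulr : forall c b a, pair c (b * iota a) = pair c b * a;
  pair_bal : forall c a b, pair (c :* a) b = pair c (iota a * b);
  (* b |-> <-, b> is a ring anti-homomorphism from B to the left dual of C *)
  pair1 : forall c, pair c 1 = counit D c;
  pairM : forall b b' c,
    pair c (b * b') = ldual_mul (pair^~ b') (pair^~ b) c;
  alpha_inj : forall M : lmodType A^c, injective (@alpha pair M)
}.

End Pairing.

Section Rat.
Variables (A B : pzRingType) (iota : {rmorphism A -> B}).
Variables (C : bimodule A) (D : coring C) (T : rational_pairing iota D).

Lemma pair_sum I (s : seq I) (F : I -> C) b :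
  T (\sum_(i <- s) F i) b = \sum_(i <- s) T (F i) b.
Proof.
apply: (big_morph (T^~ b)) => [x y|]; first exact: pairDl.
by apply: (addrI (T 0 b)); rewrite -pairDl !addr0.
Qed.

Section AlphaLemmas.
Variables (M : lmodType A^c).
Lemma alpha_balanced b :
  balanced (fun (m : M) (c : bim_left C) => m :* T c b).
Proof.
split=> [m m' c|m c c'|m a c].
- exact: rscaleDl.
- by rewrite -rscaleDr; congr (_ :* _); exact: pairDl.
- by rewrite rscaleA; congr (_ :* _); exact: esym (pair_lscale _ _ _ _).
Qed.
Lemma alpha_pure (m : M) (c : bim_left C) b : alpha T (m ⊗ c) b = m :* T c b.
Proof. exact: (tsum_pure (alpha_balanced b)). Qed.
Lemma alphaD (t u : tensor M (bim_left C)) b :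
  alpha T (t + u) b = alpha T t b + alpha T u b.
Proof. exact: (tsumD (alpha_balanced b)). Qed.
Lemma alpha0 b : alpha T (0 : tensor M (bim_left C)) b = 0.
Proof. exact: (tsum0 (alpha_balanced b)). Qed.
Lemma alpha_sum I (s : seq I) (F : I -> tensor M (bim_left C)) b :
  alpha T (\sum_(i <- s) F i) b = \sum_(i <- s) alpha T (F i) b.
Proof. exact: (tsum_sum (alpha_balanced b)). Qed.
End AlphaLemmas.

Lemma alpha_tmap (M N : lmodType A^c) (f : {linear M -> N})
    (t : tensor M (bim_left C)) b :
  alpha T (tmap f idfun t) b = f (alpha T t b).
Proof.
move: t; apply: tens_ext => [t u|t u|m c].
- by rewrite tmapD alphaD.
- by rewrite alphaD raddfD.
- by rewrite tmap_pure !alpha_pure linear_rscale.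
Qed.

(* The right B-action on C. *)
Definition coring_rscale (c : C) (b : B) : C :=
  tsum (fun (x : C) (y : bim_left C) => x :* T y b) (delta D c).

Lemma pair_coring_rscale c b b' : T (coring_rscale c b) b' = T c (b * b').
Proof. by rewrite pairM /coring_rscale /tsum pair_sum. Qed.

Section RatSubmodule.
Variable M : lmodType B^c.

Definition rational (m : M) : Prop :=
  exists s : seq (C * M),
    forall b, m :* b = \sum_(p <- s) p.2 :* iota (T p.1 b).

Lemma rational0 : rational 0.
Proof. by exists [::] => b; rewrite big_nil rscale0l. Qed.
Lemma rationalP a x y : rational x -> rational y -> rational (a *: x + y).
Proof.
move=> [s sx] [t ty]; exists ([seq (coring_rscale p.1 a, p.2) | p <- s] ++ t).
move=> b; rewrite big_cat big_map /= -ty rscaleDl; congr (_ + _).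
rewrite [LHS](rscaleA x a b) sx.
by apply: eq_bigr => p _; rewrite pair_coring_rscale.
Qed.

Definition rat_submodule := Submodule rational0 rationalP.

Definition Rat : lmodType B^c := sub_lmod rat_submodule.

Lemma tensor_rational (m : M) (t : tensor (restrict iota M) (bim_left C)) :
  (forall b, m :* b = alpha T t b) -> rational m.
Proof.
move=> mt; exists [seq (p.2 : C, p.1 : M) | p <- repr t] => b.
by rewrite mt /alpha /tsum big_map.
Qed.

Lemma rational_tensor (m : M) : rational m ->
  exists t : tensor (restrict iota M) (bim_left C),
    forall b, m :* b = alpha T t b.
Proof.
move=> [s ms]; exists (\sum_(p <- s) (p.2 : restrict iota M) ⊗ (p.1 : bim_left C)).
by move=> b; rewrite ms alpha_sum; apply: eq_bigr => p _; rewrite alpha_pure.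
Qed.

End RatSubmodule.

Definition is_rational (M : lmodType B^c) : Prop := forall m : M, rational m.

Lemma rational_map (M N : lmodType B^c) (f : {linear M -> N}) m :
  rational m -> rational (f m).
Proof.
move=> [s ms]; exists [seq (p.1, f p.2) | p <- s] => b.
rewrite -linear_rscale ms linear_sum big_map.
by apply: eq_bigr => p _; exact: linear_rscale.
Qed.

Lemma Rat_is_rational (M : lmodType B^c) : is_rational (Rat M).
Proof.
move=> m; have [t mt] := rational_tensor (smvalP m).
have S0 := rational0 M.
have SP (a : A^c) (x y : restrict iota M) :
    rational (x : M) -> rational (y : M) -> rational (a *: x + y : M).
  by move=> rx ry; exact: (rationalP (iota a : B^c) rx ry).
pose S : submodule (restrict iota M) := @Submodule _ (restrict iota M) _ S0 SP.
have [|u tu] := @tens_right_exact _ _ S C t.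
  apply: (@alpha_inj _ _ _ _ _ T); apply: funext => b.
  rewrite alpha_tmap alpha0 -mt; apply/qclP; rewrite subr0.
  exact: (smvalP (m :* b)).
have [s us] := tens_sumP u.
pose toRat (x : sub_lmod S) : Rat M :=
  smem_sub (smvalP x : rat_submodule M (smval x)).
exists [seq (p.2 : C, toRat p.1) | p <- s] => b; apply: smval_inj.
rewrite [LHS]mt tu alpha_tmap us alpha_sum raddf_sum raddf_sum big_map.
by apply: eq_bigr => p _; rewrite alpha_pure.
Qed.

Definition Rat_fun (M N : lmodType B^c) (f : {linear M -> N}) (m : Rat M) :
  Rat N := @smem_sub _ _ (rat_submodule N) _ (rational_map f (smvalP m)).
Lemma Rat_fun_linear (M N : lmodType B^c) (f : {linear M -> N}) :
  linear (Rat_fun f).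
Proof. by move=> a x y; apply: smval_inj; rewrite /= linearP. Qed.
HB.instance Definition _ (M N : lmodType B^c) (f : {linear M -> N}) :=
  GRing.isLinear.Build B^c (Rat M) (Rat N) _ _ (Rat_fun_linear f).
Definition Rat_map (M N : lmodType B^c) (f : {linear M -> N}) :
  {linear Rat M -> Rat N} := Rat_fun f.

Lemma Rat_map1 (M : lmodType B^c) : Rat_map (lmod_id M) = lmod_id (Rat M).
Proof. by apply: linear_eq => x; apply: smval_inj. Qed.
Lemma Rat_mapM (M N P : lmodType B^c) (g : {linear N -> P})
    (f : {linear M -> N}) :
  Rat_map (lmod_comp g f) = lmod_comp (Rat_map g) (Rat_map f).
Proof. by apply: linear_eq => x; apply: smval_inj. Qed.

Definition RatMod : category := full_subcat (is_rational : Mod B -> Prop).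

Definition RatMod_incl : functor RatMod (Mod B) := full_incl _.

(* Rat as a functor Mod_B -> Rat(Mod_B), and as an endofunctor of Mod_B. *)
Definition Rat_functor : functor (Mod B) RatMod := @Functor (Mod B) RatMod
  (fun M => FullOb (@Rat_is_rational M)) Rat_map Rat_map1 Rat_mapM.

Definition Rat_endofunctor : functor (Mod B) (Mod B) :=
  comp_functor RatMod_incl Rat_functor.

End Rat.

(* Hom_R(P, M) as a right R-module, (f b)(x) = f (b x). *)
Definition hom_right (R : pzRingType) (P : bimodule R) (M : lmodType R^c) :
  Type := {linear P -> M}.

Section HomRight.
Variables (R : pzRingType) (P : bimodule R) (M : lmodType R^c).

HB.instance Definition _ := gen_eqMixin (hom_right P M).
HB.instance Definition _ := gen_choiceMixin (hom_right P M).

Definition hom_add (f g : hom_right P M) : hom_right P M :=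
  (f : {linear P -> M}) \+ (g : {linear P -> M}).
Definition hom_opp (f : hom_right P M) : hom_right P M :=
  \- (f : {linear P -> M}).
Definition hom_zero : hom_right P M := (\0 : {linear P -> M}).

Lemma hom_addA : associative hom_add.
Proof. by move=> f g h; apply: linear_eq => x; exact: addrA. Qed.
Lemma hom_addC : commutative hom_add.
Proof. by move=> f g; apply: linear_eq => x; exact: addrC. Qed.
Lemma hom_add0 : left_id hom_zero hom_add.
Proof. by move=> f; apply: linear_eq => x; exact: add0r. Qed.
Lemma hom_addN : left_inverse hom_zero hom_opp hom_add.
Proof. by move=> f; apply: linear_eq => x; exact: addNr. Qed.
HB.instance Definition _ :=
  GRing.isZmodule.Build (hom_right P M) hom_addA hom_addC hom_add0 hom_addN.

Lemma lscale_linear (b : R) : linear (@lscale R P b).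
Proof.
by move=> a x y; rewrite lscaleDr; congr (_ + _); exact: lscale_rscale.
Qed.
HB.instance Definition _ (b : R) :=
  GRing.isLinear.Build R^c P P _ (@lscale R P b) (lscale_linear b).

Definition hom_rscale (b : R^c) (f : hom_right P M) : hom_right P M :=
  (f : {linear P -> M}) \o @lscale R P b.

Lemma hom_rscaleA a b f : hom_rscale a (hom_rscale b f) = hom_rscale (a * b) f.
Proof. by apply: linear_eq => x /=; rewrite lscaleA. Qed.
Lemma hom_rscale1 : left_id 1 hom_rscale.
Proof. by move=> f; apply: linear_eq => x /=; rewrite lscale1. Qed.
Lemma hom_rscaleDr : right_distributive hom_rscale +%R.
Proof. by move=> a f g; exact: linear_eq. Qed.
Lemma hom_rscaleDl f : {morph hom_rscale^~ f : a b / a + b}.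
Proof. by move=> a b; apply: linear_eq => x /=; rewrite lscaleDl raddfD. Qed.
HB.instance Definition _ := GRing.Zmodule_isLmodule.Build R^c (hom_right P M)
  hom_rscaleA hom_rscale1 hom_rscaleDr hom_rscaleDl.
End HomRight.

Section HomFunctor.
Variables (R : pzRingType) (P : bimodule R).

Definition hom_post (M N : lmodType R^c) (g : {linear M -> N})
  (f : hom_right P M) : hom_right P N := lmod_comp g f.
Lemma hom_post_linear (M N : lmodType R^c) (g : {linear M -> N}) :
  linear (hom_post g).
Proof. by move=> a f h; apply: linear_eq => x /=; rewrite raddfD. Qed.
HB.instance Definition _ (M N : lmodType R^c) (g : {linear M -> N}) :=
  GRing.isLinear.Build R^c (hom_right P M) (hom_right P N) _ _
    (hom_post_linear g).

Lemma hom_functor1 (M : lmodType R^c) :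
  (hom_post (lmod_id M) : {linear _ -> _}) = lmod_id (hom_right P M).
Proof. by apply: linear_eq => f; exact: linear_eq. Qed.
Lemma hom_functorM (M N Q : lmodType R^c) (g : {linear N -> Q})
    (f : {linear M -> N}) :
  (hom_post (lmod_comp g f) : {linear _ -> _}) =
  lmod_comp (hom_post g) (hom_post f).
Proof. by apply: linear_eq => h; exact: linear_eq. Qed.

Definition hom_functor : functor (Mod R) (Mod R) := @Functor (Mod R) (Mod R)
  (fun M => hom_right P M : lmodType R^c) (fun M N g => hom_post g) hom_functor1 hom_functorM.
End HomFunctor.

Definition flat (R : pzRingType) (N : lmodType R) : Prop :=
  forall (M M' : lmodType R^c) (f : {linear M -> M'}),
    injective f -> injective (tmap f idfun : tensor M N -> tensor M' N).

Definition pure (R : pzRingType) (N : lmodType R) (S : submodule N) : Prop :=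
  forall M : lmodType R^c,
    injective (tmap idfun (@smval _ _ S) :
      tensor M (sub_lmod S) -> tensor M N).

Section RatIdeal.
Variables (A B : pzRingType) (iota : {rmorphism A -> B}).
Variables (C : bimodule A) (D : coring C) (T : rational_pairing iota D).

(* Membership in the ideal a = Rat(B_B) of B. *)
Definition in_rat_ideal (b : B) : Prop := @rational _ _ _ _ _ T B^c^o b.

Lemma in_rat_ideal_mull (b x : B) : in_rat_ideal x -> in_rat_ideal (b * x).
Proof.
move=> [s xs]; exists [seq (p.1, b * p.2 : B) | p <- s] => b'.
have /= := xs b'; rewrite /rscale /= /GRing.scale /= => {}xs.
rewrite -[LHS]mulrA [x * b']xs mulr_sumr big_map.
apply: eq_bigr => p _; exact: (@mulrA B b p.2 (iota (T p.1 b'))).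
Qed.

Definition rat_lscale (b : B) (x : Rat T B^c^o) : Rat T B^c^o :=
  @smem_sub _ _ (rat_submodule T B^c^o) _ (in_rat_ideal_mull b (smvalP x)).

(* a as a B-bimodule. *)
Definition rat_ideal : bimodule B.
Proof.
apply: (@Bimodule B (Rat T B^c^o) rat_lscale).
- by move=> a b x; apply: smval_inj; exact: (@mulrA B a b (smval x)).
- by move=> x; apply: smval_inj; exact: (@mul1r B (smval x)).
- move=> a x y; apply: smval_inj.
  exact: (@mulrDr B a (smval x) (smval y)).
- by move=> a b x; apply: smval_inj; exact: (@mulrDl B a b (smval x)).
- by move=> a x b; apply: smval_inj; exact: (@mulrA B a (smval x) b).
Defined.

Definition rat_ideal_val (x : rat_ideal) : B := smval (x : Rat T B^c^o).

(* a as a submodule of the left B-module B. *)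
Lemma rat_left_ideal0 : in_rat_ideal 0. Proof. exact: rational0. Qed.
Lemma rat_left_idealP (b x y : B) :
  in_rat_ideal x -> in_rat_ideal y -> in_rat_ideal (b * x + y).
Proof.
move=> /(in_rat_ideal_mull b) bx ry.
by have := rationalP 1 bx ry; rewrite scale1r.
Qed.
Definition rat_left_ideal : submodule B^o :=
  @Submodule B B^o in_rat_ideal rat_left_ideal0 rat_left_idealP.

Definition rat_ideal_idempotent : Prop :=
  forall x : B, in_rat_ideal x <->
    exists s : seq (B * B),
      (forall p, p \in s -> in_rat_ideal p.1 /\ in_rat_ideal p.2) /\
      x = \sum_(p <- s) p.1 * p.2.

(* C a = C *)
Definition coring_rat_ideal_full : Prop :=
  forall c : C, exists s : seq (C * B),
    (forall p, p \in s -> in_rat_ideal p.2) /\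
    c = \sum_(p <- s) coring_rscale T p.1 p.2.

(* The coring structure on a whose counit is the inclusion a -> B and whose *)
(* comultiplication is inverse to the multiplication map a ⊗_B a -> a. *)
Definition is_idempotent_coring (E : coring rat_ideal) : Prop :=
  let mul (t : tens_right rat_ideal rat_ideal) : rat_ideal :=
    tsum (fun (x : rat_ideal) (y : bim_left rat_ideal) => x :* rat_ideal_val y) t
  in [/\ forall x, counit E x = rat_ideal_val x,
         cancel (delta E) mul & cancel mul (delta E)].

Definition delta_left (D : coring C) :
  bim_left C -> bim_left (tens_bim C C) := delta D.
Lemma delta_left_linear :
  linear (delta_left D).
Proof.
move=> a x y; rewrite [LHS]raddfD; congr (_ + _); exact: delta_lscale.
Qed.
HB.instance Definition _ :=
  GRing.isLinear.Build A (bim_left C) (bim_left (tens_bim C C)) _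
    (delta_left D) delta_left_linear.

(* A right C-comodule M as a right B-module, m b = sum m_(0) <m_(1), b>. *)
Definition comod_mod (S : rational_pairing iota D) (M : comodule D) : Type :=
  cm_right M.

Section ComodMod.
Variable M : comodule D.
HB.instance Definition _ := GRing.Zmodule.on (comod_mod T M).

Definition comod_mod_scale (b : B^c) (m : comod_mod T M) : comod_mod T M :=
  alpha T (coact M m) b.

Lemma comod_mod_scaleDr : right_distributive comod_mod_scale +%R.
Proof. by move=> b m n; rewrite /comod_mod_scale raddfD alphaD. Qed.

Lemma alphaDr (t : tensor M (bim_left C)) b b' :
  alpha T t (b + b') = alpha T t b + alpha T t b'.
Proof.
rewrite /alpha /tsum -big_split; apply: eq_bigr => p _ /=.
by rewrite pairDr rscaleDr.
Qed.

Lemma comod_mod_scaleDl m : {morph comod_mod_scale^~ m : a b / a + b}.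
Proof. by move=> a b; exact: alphaDr. Qed.

Lemma comod_mod_scale1 : left_id 1 comod_mod_scale.
Proof.
move=> m; rewrite -[RHS](coact1 m) /comod_mod_scale /alpha /tsum.
by apply: eq_bigr => p _; rewrite (pair1 T).
Qed.

Lemma alpha_rscale (N : lmodType A^c) (t : tens_right N C) a b :
  alpha T (t :* a) b = alpha T t (iota a * b).
Proof.
move: t; apply: tens_ext => [t u|t u|m c].
- by rewrite (rscaleDl (t : tens_right N C)) alphaD.
- by rewrite alphaD.
- by rewrite tens_right_pure !alpha_pure; congr (_ :* _); exact: pair_bal.
Qed.

Lemma coring_rscale_balanced b :
  balanced (fun (x : C) (y : bim_left C) => x :* T y b).
Proof. exact: alpha_balanced. Qed.

Lemma comod_mod_scaleA a b m :
  comod_mod_scale a (comod_mod_scale b m) = comod_mod_scale (a * b) m.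
Proof.
pose inner (w : bim_left (tens_bim C C)) : A :=
  T (tsum (fun (x : C) (y : bim_left C) => x :* T y b) w) a.
pose Psi (t : tensor M (bim_left (tens_bim C C))) : M :=
  tsum (fun (m : M) (w : bim_left (tens_bim C C)) => m :* inner w) t.
have bPsi : balanced (fun (m : M) (w : bim_left (tens_bim C C)) => m :* inner w).
  split=> [x y w|x w w'|x c w]; first exact: rscaleDl.
    rewrite -rscaleDr; congr (_ :* _); rewrite /inner -pairDl; congr (T _ a).
    exact: (tsumD (coring_rscale_balanced b)).
  rewrite rscaleA; congr (_ :* _); rewrite /inner -pair_lscale; congr (T _ a).
  move: w; apply: tens_ext => [w w'|w w'|y z].
  - by rewrite (tsumD (coring_rscale_balanced b)) lscaleDr.
  - by rewrite scalerDr (tsumD (coring_rscale_balanced b)).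
  - rewrite (tsum_pure (coring_rscale_balanced b)) lscale_rscale.
    rewrite [_ *: _](tens_lscale_pure c (y : C) z).
    by rewrite (tsum_pure (coring_rscale_balanced b)).
have PsiD t u : Psi (t + u) = Psi t + Psi u := tsumD bPsi t u.
have Psi_pure x w : Psi (x ⊗ w) = x :* inner w := tsum_pure bPsi x w.
have PsiR t : Psi (tmap idfun (delta_left D) t) = alpha T t (a * b).
  move: t; apply: tens_ext => [t u|t u|x c].
  - by rewrite tmapD PsiD.
  - by rewrite alphaD.
  - rewrite tmap_pure Psi_pure alpha_pure; congr (_ :* _).
    exact: (pair_coring_rscale T c b a).
have PsiA (u : tens_right M C) (q : bim_left C) :
    Psi (tassoc (u ⊗ q)) = alpha T (u :* T q b) a.
  move: u; apply: tens_ext => [t u|t u|x p].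
  - by rewrite tpureDl tassocD PsiD.
  - by rewrite (rscaleDl (t : tens_right M C)) alphaD.
  - rewrite tassoc_pure Psi_pure tens_right_pure alpha_pure.
    by congr (_ :* _); rewrite /inner (tsum_pure (coring_rscale_balanced b)).
have PsiL (t : tens_right M C) : Psi (tassoc (tmap (coact M) idfun t)) =
    alpha T (coact M (alpha T t b)) a.
  move: t; apply: tens_ext => [t u|t u|x c].
  - by rewrite tmapD tassocD PsiD.
  - by rewrite alphaD raddfD alphaD.
  - by rewrite tmap_pure PsiA alpha_pure linear_rscale.
by rewrite /comod_mod_scale -[RHS]PsiR -PsiL; congr Psi; exact: coactA.
Qed.

HB.instance Definition _ := GRing.Zmodule_isLmodule.Build B^c (comod_mod T M)
  comod_mod_scaleA comod_mod_scale1 comod_mod_scaleDr comod_mod_scaleDl.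

Lemma comod_mod_iota (m : comod_mod T M) a : m :* iota a = (m : M) :* a.
Proof.
rewrite -[in RHS](coact1 (m : M)) /tsum rscale_suml.
apply: eq_bigr => p _.
by rewrite rscaleA -[iota a]mul1r pair_mulr (pair1 T).
Qed.

Lemma comod_mod_rational : is_rational T (comod_mod T M).
Proof.
move=> m; exists [seq (p.2 : C, p.1 : comod_mod T M) | p <- repr (coact M m)] => b.
rewrite big_map; apply: eq_bigr => p _; exact: esym (comod_mod_iota _ _).
Qed.
End ComodMod.

Definition comod_mod_fun (M N : comodule D) (f : comod_hom M N)
  (m : comod_mod T M) : comod_mod T N := f m.
Lemma comod_mod_linear (M N : comodule D) (f : comod_hom M N) :
  linear (comod_mod_fun f).
Proof.
move=> b m n; rewrite /comod_mod_fun [LHS]raddfD; congr (_ + _).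
by rewrite [RHS]/(alpha T (coact N (f m)) b) cm_mapP; exact: esym (alpha_tmap T f _ b).
Qed.
HB.instance Definition _ (M N : comodule D) (f : comod_hom M N) :=
  GRing.isLinear.Build B^c (comod_mod T M) (comod_mod T N) _ _ (comod_mod_linear f).
Definition comod_mod_map (M N : comodule D) (f : comod_hom M N) :
  {linear comod_mod T M -> comod_mod T N} := comod_mod_fun f.

Lemma comod_mod_map1 (M : comodule D) :
  comod_mod_map (comod_id M) = lmod_id (comod_mod T M).
Proof. exact: linear_eq. Qed.
Lemma comod_mod_mapM (M N P : comodule D) (g : comod_hom N P)
    (f : comod_hom M N) :
  comod_mod_map (comod_comp g f) = lmod_comp (comod_mod_map g) (comod_mod_map f).
Proof. exact: linear_eq. Qed.

Definition comod_RatMod : functor (Comod D) (RatMod T) :=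
  @Functor (Comod D) (RatMod T) (fun M => FullOb (@comod_mod_rational M))
    comod_mod_map comod_mod_map1 comod_mod_mapM.

End RatIdeal.

Record localizing (R : pzRingType) (L : lmodType R -> Prop) : Prop :=
  Localizing {
    localizing_coproduct : forall (I : Type) (X : I -> lmod_cat R) (Y : lmod_cat R)
      (inj : forall i, hom (X i) Y),
      is_coproduct inj -> (forall i, L (X i)) -> L Y;
    localizing_exact : forall (X Y Z : lmodType R)
      (f : {linear X -> Y}) (g : {linear Y -> Z}),
      short_exact f g -> (L Y <-> L X /\ L Z)
  }.

Section GabrielQuotient.
Variables (R : pzRingType) (L : lmodType R -> Prop).

Section Graph.
Variables X Y : lmodType R.
Implicit Types G H : submodule (X * Y)%type.

Definition gdom G : submodule X.
Proof.
apply: (@Submodule R X (fun x => exists y, G (x, y))).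
  by exists 0; exact: (smem0 G).
by move=> a x x' [y Gy] [y' Gy']; exists (a *: y + y'); exact: (smemP a Gy Gy').
Defined.

Definition gind G : submodule Y.
Proof.
apply: (@Submodule R Y (fun y => G (0, y))); first exact: (smem0 G).
move=> a y y' Gy Gy'.
have : G (a *: 0 + 0, a *: y + y') := smemP a Gy Gy'.
by rewrite scaler0 addr0.
Defined.

(* A morphism X -> Y of the quotient category is represented by a linear map *)
(* f : X' -> Y / Y' with X' a submodule of X, Y' a submodule of Y, and X / X' *)
(* and Y' in L. Such an f is the same as its graph, the submodule *)
(* {(x, y) | x in X' and f x = y + Y'} of X * Y, from which X' and Y' are *)
(* recovered as gdom and gind. *)
Record frac := Frac {
  graph :> submodule (X * Y)%type;
  frac_dom : L (quot_lmod (gdom graph));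
  frac_ind : L (sub_lmod (gind graph))
}.

(* F' : X'' -> Y / Y'' is the image of F : X' -> Y / Y' under the transition *)
(* map, for X'' contained in X' and Y' contained in Y''. *)
Definition refines (F' F : frac) : Prop :=
  forall x, gdom F' x -> gdom F x /\ forall y, F (x, y) -> F' (x, y).

(* Equality in the direct limit of the Hom(X', Y / Y'). *)
Definition frac_eqv (F G : frac) : Prop :=
  exists H : frac, refines H F /\ refines H G.

End Graph.

Hypothesis hL : localizing L.

Lemma loc_zero (M : lmodType R) : (forall x : M, x = 0) -> L M.
Proof.
move=> M0; pose X (i : void) : lmod_cat R := M.
apply: (@localizing_coproduct _ _ hL void X M (fun i => idm (X i))) => [Z f|[]].
exists (\0 : {linear M -> Z}); split=> [[]|h _].
by apply: linear_eq => x; rewrite (M0 x) !raddf0.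
Qed.

Lemma loc_inj (X Y : lmodType R) (f : {linear X -> Y}) :
  injective f -> L Y -> L X.
Proof.
move=> finj.
have i0 : exists x, 0 = f x by exists 0; rewrite raddf0.
have iP a (y z : Y) : (exists x, y = f x) -> (exists x, z = f x) ->
    exists x, a *: y + z = f x.
  by move=> [x ->] [x' ->]; exists (a *: x + x'); rewrite linearP.
pose S := Submodule i0 iP.
have se : short_exact f (qcl S).
  split=> // [y|z]; last by exists (repr z); exact: esym (qclK z).
  rewrite -[0](raddf0 (qcl S)); split=> [/qclP|Sy]; first by rewrite subr0.
  by apply/qclP; rewrite subr0.
by case/(localizing_exact hL se).
Qed.

Lemma loc_surj (X Y : lmodType R) (f : {linear X -> Y}) :
  (forall y, exists x, y = f x) -> L X -> L Y.
Proof.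
move=> fsurj.
have k0 : f 0 = 0 by rewrite raddf0.
have kP a (x x' : X) : f x = 0 -> f x' = 0 -> f (a *: x + x') = 0.
  by move=> fx fx'; rewrite linearP fx fx' scaler0 addr0.
pose S := @Submodule R X (fun x => f x = 0) k0 kP.
have se : short_exact (@smval _ _ S) f.
  split=> // [|x]; first exact: smval_inj.
  split=> [fx|[k ->]]; last exact: (smvalP k).
  by exists (@smem_sub _ _ S x fx).
by case/(localizing_exact hL se).
Qed.

Lemma loc_ker (X Y : lmodType R) (f : {linear X -> Y}) (N : lmodType R)
    (k : {linear N -> X}) :
  (forall x, f x = 0 -> exists n, x = k n) -> L N -> L Y -> L X.
Proof.
move=> fk LN LY.
have k0 : f 0 = 0 by rewrite raddf0.
have kP a (x x' : X) : f x = 0 -> f x' = 0 -> f (a *: x + x') = 0.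
  by move=> fx fx'; rewrite linearP fx fx' scaler0 addr0.
pose S := @Submodule R X (fun x => f x = 0) k0 kP.
have q0 : exists x, 0 = f x by exists 0; rewrite raddf0.
have qP a (y z : Y) : (exists x, y = f x) -> (exists x, z = f x) ->
    exists x, a *: y + z = f x.
  by move=> [x ->] [x' ->]; exists (a *: x + x'); rewrite linearP.
pose I := Submodule q0 qP.
pose g (x : X) : sub_lmod I := @smem_sub _ _ I (f x) (ex_intro _ x erefl).
have gL : linear g by move=> a x y; apply: smval_inj; rewrite /= linearP.
pose gl : {linear X -> sub_lmod I} :=
  HB.pack g (GRing.isLinear.Build R X (sub_lmod I) _ g gL).
have se : short_exact (@smval _ _ S) gl.
  split=> // [|x|z]; first exact: smval_inj.
    split=> [gx|[n ->]].
      have fx : f x = 0 by have := congr1 (@smval _ _ I) gx.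
      by exists (@smem_sub _ _ S x fx).
    by apply: smval_inj; exact: (smvalP n).
  by have [x zx] := smvalP z; exists x; exact: smval_inj.
apply/(localizing_exact hL se); split; last first.
  by apply: (loc_inj (f := @smval _ _ I)) LY; exact: smval_inj.
have n0 : f (k 0) = 0 by rewrite !raddf0.
have nP a (x y : N) : f (k x) = 0 -> f (k y) = 0 -> f (k (a *: x + y)) = 0.
  by move=> fx fy; rewrite !linearP fx fy scaler0 addr0.
pose K := @Submodule R N (fun n => f (k n) = 0) n0 nP.
have LK : L (sub_lmod K).
  by apply: (loc_inj (f := @smval _ _ K)) LN; exact: smval_inj.
pose h (n : sub_lmod K) : sub_lmod S := @smem_sub _ _ S (k (smval n)) (smvalP n).
have hlin : linear h by move=> a x y; apply: smval_inj; rewrite /= linearP.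
pose hl : {linear sub_lmod K -> sub_lmod S} :=
  HB.pack h (GRing.isLinear.Build R (sub_lmod K) (sub_lmod S) _ h hlin).
apply: (loc_surj (f := hl)) LK => x.
have [n xn] := fk _ (smvalP x).
have fkn : K n by rewrite /K /= -xn; exact: (smvalP x).
by exists (@smem_sub _ _ K n fkn); apply: smval_inj.
Qed.

(* An additive relation W, total on M, with Q and {m | W (m, 0)} in L. *)
Lemma loc_rel (M Q : lmodType R) (W : submodule (M * Q)%type)
    (N : submodule M) :
  (forall m, exists q, W (m, q)) -> (forall m, W (m, 0) -> N m) ->
  L Q -> L (sub_lmod N) -> L M.
Proof.
move=> Wtot WN LQ LN.
pose f1 (w : sub_lmod W) : M := (smval w).1.
pose f2 (w : sub_lmod W) : Q := (smval w).2.
have l1 : linear f1 by [].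
have l2 : linear f2 by [].
pose F1 : {linear sub_lmod W -> M} := HB.pack f1 (GRing.isLinear.Build _ _ _ _ f1 l1).
pose F2 : {linear sub_lmod W -> Q} := HB.pack f2 (GRing.isLinear.Build _ _ _ _ f2 l2).
have z0 : W (0, 0) by exact: (smem0 W).
have zP a (x y : M) : W (x, 0) -> W (y, 0) -> W (a *: x + y, 0).
  move=> wx wy.
  have : W (a *: x + y, a *: 0 + 0) := smemP a wx wy.
  by rewrite scaler0 addr0.
pose Z := @Submodule R M (fun m => W (m, 0)) z0 zP.
have LZ : L (sub_lmod Z).
  pose j (z : sub_lmod Z) : sub_lmod N := smem_sub (WN _ (smvalP z)).
  have jl : linear j by move=> a x y; exact: smval_inj.
  pose J : {linear sub_lmod Z -> sub_lmod N} :=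
    HB.pack j (GRing.isLinear.Build _ _ _ _ j jl).
  apply: (loc_inj (f := J)) LN => x y /(congr1 (@smval _ _ N)) xy.
  exact: smval_inj.
pose k (z : sub_lmod Z) : sub_lmod W := @smem_sub _ _ W (smval z, 0) (smvalP z).
have kl : linear k.
  move=> a x y; apply: smval_inj.
  rewrite -[RHS]/(a *: smval x + smval y, a *: 0 + 0 : Q).
  by rewrite scaler0 addr0.
pose K : {linear sub_lmod Z -> sub_lmod W} :=
  HB.pack k (GRing.isLinear.Build _ _ _ _ k kl).
have LW : L (sub_lmod W).
  apply: (@loc_ker _ _ F2 _ K) LZ LQ => w w0.
  have Ww : Z (smval w).1.
    have := smvalP w; rewrite [smval w]surjective_pairing.
    by rewrite /= -[(smval w).2]/(F2 w) w0.
  exists (@smem_sub _ _ Z _ Ww); apply: smval_inj.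
  by rewrite /= [smval w]surjective_pairing -[(smval w).2]/(F2 w) w0.
apply: (loc_surj (f := F1)) LW => m; have [q Wm] := Wtot m.
by exists (@smem_sub _ _ W _ Wm).
Qed.

Lemma loc_subset (M : lmodType R) (S N : submodule M) :
  (forall m, S m -> N m) -> L (sub_lmod N) -> L (sub_lmod S).
Proof.
move=> SN.
pose j (z : sub_lmod S) : sub_lmod N := smem_sub (SN _ (smvalP z)).
have jl : linear j by move=> a x y; exact: smval_inj.
pose J : {linear sub_lmod S -> sub_lmod N} :=
  HB.pack j (GRing.isLinear.Build _ _ _ _ j jl).
apply: (loc_inj (f := J)) => x y /(congr1 (@smval _ _ N)) xy.
exact: smval_inj.
Qed.

Lemma loc_sub (M Q : lmodType R) (W : submodule (M * Q)%type)
    (S N : submodule M) :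
  (forall m, S m -> exists q, W (m, q)) ->
  (forall m, S m -> W (m, 0) -> N m) ->
  L Q -> L (sub_lmod N) -> L (sub_lmod S).
Proof.
move=> Wtot WN LQ LN.
have w0 : W (smval (0 : sub_lmod S), 0) by exact: (smem0 W).
have wP a (x y : sub_lmod S * Q) : W (smval x.1, x.2) -> W (smval y.1, y.2) ->
  W (smval (a *: x + y).1, (a *: x + y).2) by exact: (smemP a).
pose W' := @Submodule R (sub_lmod S * Q)%type (fun p => W (smval p.1, p.2)) w0 wP.
have n0 : N (smval (0 : sub_lmod S)) by exact: (smem0 N).
have nP a (x y : sub_lmod S) : N (smval x) -> N (smval y) ->
  N (smval (a *: x + y)) by exact: (smemP a).
pose N' := @Submodule R (sub_lmod S) (fun p => N (smval p)) n0 nP.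
apply: (@loc_rel _ _ W' N') LQ _ => [m|m|].
- by apply: Wtot; exact: smvalP.
- by apply: WN; exact: smvalP.
pose j (z : sub_lmod N') : sub_lmod N := @smem_sub _ _ N _ (smvalP z).
have jl : linear j by move=> a x y; exact: smval_inj.
pose J : {linear sub_lmod N' -> sub_lmod N} :=
  HB.pack j (GRing.isLinear.Build _ _ _ _ j jl).
apply: (loc_inj (f := J)) LN => x y /(congr1 (@smval _ _ N)) xy.
by apply: smval_inj; exact: smval_inj.
Qed.

Lemma loc_dense (M Q : lmodType R) (W : submodule (M * Q)%type)
    (S N : submodule M) :
  (forall m, N m -> exists q, W (m, q)) ->
  (forall m, N m -> W (m, 0) -> S m) ->
  L (quot_lmod N) -> L Q -> L (quot_lmod S).
Proof.
move=> Wtot WS LN LQ.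
pose V1 (p : quot_lmod S * quot_lmod N) :=
  exists x, p.1 = qcl S x /\ p.2 = qcl N x.
have v0 : V1 0 by exists 0; rewrite !raddf0.
have vP a p q : V1 p -> V1 q -> V1 (a *: p + q).
  by move=> [x [p1 p2]] [y [q1 q2]]; exists (a *: x + y);
     rewrite !qclL -p1 -p2 -q1 -q2.
pose N1 (p : quot_lmod S) := exists x, N x /\ p = qcl S x.
have n0 : N1 0 by exists 0; rewrite raddf0; split=> //; exact: smem0.
have nP a p q : N1 p -> N1 q -> N1 (a *: p + q).
  move=> [x [Nx ->]] [y [Ny ->]]; exists (a *: x + y).
  by rewrite linearP; split=> //; exact: smemP.
apply: (@loc_rel _ _ (Submodule v0 vP) (Submodule n0 nP)) LN _ => [p|p|].
- by exists (qcl N (repr p)), (repr p); split=> //; exact: esym (qclK p).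
- move=> [x [px x0]]; exists x; split=> //.
  have /qclP : qcl N x = qcl N 0 by rewrite raddf0.
  by rewrite subr0.
pose V2 (p : quot_lmod S * Q) := exists x, [/\ N x, p.1 = qcl S x & W (x, p.2)].
have u0 : V2 0 by exists 0; split; [exact: smem0|rewrite raddf0|exact: (smem0 W)].
have uP a p q : V2 p -> V2 q -> V2 (a *: p + q).
  move=> [x [Nx p1 Wx]] [y [Ny q1 Wy]]; exists (a *: x + y); split.
  - exact: smemP.
  - by rewrite qclL -p1 -q1.
  - exact: (smemP a Wx Wy).
have z0 : (0 : quot_lmod S) = 0 by [].
have zP a (p q : quot_lmod S) : p = 0 -> q = 0 -> a *: p + q = 0.
  by move=> -> ->; rewrite scaler0 addr0.
apply: (@loc_sub _ _ (Submodule u0 uP) (Submodule n0 nP) (Submodule z0 zP)) LQ _.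
- by move=> p [x [Nx ->]]; have [q Wq] := Wtot x Nx; exists q, x.
- move=> p _ [x [Nx /= -> Wx]]; rewrite -[0](raddf0 (qcl S)); apply/qclP.
  by rewrite subr0; exact: WS.
- by apply: loc_zero => -[x x0]; apply: smval_inj; exact: (asboolW x0).
Qed.

Section Diff.
Variables X Y : lmodType R.
Implicit Types F G H : frac X Y.

Definition gdiff F G : submodule Y.
Proof.
apply: (@Submodule R Y
  (fun d => exists x y y', [/\ F (x, y), G (x, y') & d = y - y'])).
  by exists 0, 0, 0; split; [exact: (smem0 F)|exact: (smem0 G)|rewrite subr0].
move=> a d d' [x [y [y' [Fy Gy ->]]]] [u [v [v' [Fv Gv ->]]]].
exists (a *: x + u), (a *: y + v), (a *: y' + v').
split; [exact: (smemP a Fy Fv)|exact: (smemP a Gy Gv)|].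
by rewrite scalerBr addrACA -opprD.
Defined.

Lemma graph_sub F x y x' y' : F (x, y) -> F (x', y') -> F (x - x', y - y').
Proof. by move=> Fx Fx'; exact: (smemD Fx (smemN Fx')). Qed.

Lemma graph_ind F x y y' : F (x, y) -> F (x, y') -> F (0, y - y').
Proof. by move=> Fx Fx'; rewrite -(subrr x); exact: graph_sub. Qed.

Lemma frac_eqvP F G : frac_eqv F G <-> L (sub_lmod (gdiff F G)).
Proof.
split=> [[T [TF TG]]|LD].
  pose W (p : Y * quot_lmod (gdom T)) := exists x y y',
    [/\ F (x, y), G (x, y'), p.1 = y - y' & p.2 = qcl (gdom T) x].
  have w0 : W 0.
    exists 0, 0, 0; rewrite subrr raddf0.
    by split=> //; [exact: (smem0 F)|exact: (smem0 G)].
  have wP a p q : W p -> W q -> W (a *: p + q).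
    move=> [x [y [y' [Fy Gy p1 p2]]]] [u [v [v' [Fv Gv q1 q2]]]].
    exists (a *: x + u), (a *: y + v), (a *: y' + v').
    split; [exact: (smemP a Fy Fv)|exact: (smemP a Gy Gv)| |].
      by rewrite /= p1 q1 scalerBr addrACA -opprD.
    by rewrite qclL -p2 -q2.
  apply: (@loc_sub _ _ (Submodule w0 wP) _ (gind T)) (frac_dom T) (frac_ind T).
    move=> d [x [y [y' [Fy Gy ->]]]].
    by exists (qcl (gdom T) x), x, y, y'.
  move=> d _ [x [y [y' [Fy Gy /= -> x0]]]].
  have Tx : gdom T x.
    have /qclP : qcl (gdom T) x = qcl (gdom T) 0 by rewrite raddf0.
    by rewrite subr0.
  have [_ TFx] := TF x Tx; have [_ TGx] := TG x Tx.
  exact: graph_ind (TFx _ Fy) (TGx _ Gy).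
pose D := gdiff F G.
pose T (p : X * Y) := gdom G p.1 /\ exists y0, F (p.1, y0) /\ D (p.2 - y0).
have t0 : T 0.
  split; first exact: (smem0 (gdom G)).
  by exists 0; split; [exact: (smem0 F)|rewrite subrr; exact: (smem0 D)].
have tP a p q : T p -> T q -> T (a *: p + q).
  move=> [Gp [y [Fy Dy]]] [Gq [z [Fz Dz]]]; split; first exact: (smemP a Gp Gq).
  exists (a *: y + z); split; first exact: (smemP a Fy Fz).
  by have := smemP a Dy Dz; rewrite scalerBr addrACA -opprD.
pose TT := @Submodule R (X * Y)%type T t0 tP.
have T1 : L (quot_lmod (gdom TT)).
  have g0 : (0 : X * quot_lmod (gdom G)).2 = qcl (gdom G) 0 by rewrite raddf0.
  have gP a (p q : X * quot_lmod (gdom G)) : p.2 = qcl (gdom G) p.1 ->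
      q.2 = qcl (gdom G) q.1 -> (a *: p + q).2 = qcl (gdom G) (a *: p + q).1.
    by move=> p2 q2; rewrite qclL -p2 -q2.
  pose W := @Submodule R (X * quot_lmod (gdom G))%type
    (fun p => p.2 = qcl (gdom G) p.1) g0 gP.
  apply: (@loc_dense _ _ W _ (gdom F)) (frac_dom F) (frac_dom G) => x.
    by move=> _; exists (qcl (gdom G) x).
  move=> [y Fy] /= x0.
  have Gx : gdom G x.
    have /qclP : qcl (gdom G) x = qcl (gdom G) 0 by rewrite raddf0.
    by rewrite subr0.
  by exists y; split=> //; exists y; rewrite subrr; split=> //; exact: (smem0 D).
have T2 : L (sub_lmod (gind TT)).
  apply: loc_subset LD => y [_ [y0 [/= Fy Dy]]].
  have Dy0 : D y0.
    by exists 0, y0, 0; split=> //; [exact: (smem0 G)|rewrite subr0].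
  by have := @smemD _ _ D _ _ Dy Dy0; rewrite subrK.
exists (Frac T1 T2); split=> x [y [[y' Gx] [y0 [/= Fx Dy]]]].
  split; first by exists y0.
  move=> z Fz; split; first by exists y'.
  by exists z; rewrite subrr; split=> //; exact: (smem0 D).
split; first by exists y'.
move=> z Gz; split; first by exists z.
exists y0; split=> //; rewrite -opprB; apply: (@smemN _ _ D).
by exists x, y0, z.
Qed.

Lemma frac_ext F G : (forall p, F p <-> G p) -> frac_eqv F G.
Proof.
move=> FG; exists F; split=> x [y Fxy]; first by split=> //; exists y.
by split=> [|z /FG //]; exists y; exact/FG.
Qed.

Lemma loc_sum (N1 N2 S : submodule Y) :
  (forall y, S y -> exists y1 y2, [/\ N1 y1, N2 y2 & y = y1 + y2]) ->
  L (sub_lmod N1) -> L (sub_lmod N2) -> L (sub_lmod S).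
Proof.
move=> SN L1 L2.
pose W (p : Y * sub_lmod N2) := N1 (p.1 - smval p.2).
have w0 : W 0 by rewrite /W /= subr0; exact: smem0.
have wP a p q : W p -> W q -> W (a *: p + q).
  by move=> Wp Wq; have := smemP a Wp Wq; rewrite scalerBr addrACA -opprD.
apply: (@loc_sub _ _ (Submodule w0 wP) _ N1) L2 L1 => y Sy.
  have [y1 [y2 [Ny1 Ny2 ->]]] := SN y Sy.
  by exists (smem_sub Ny2); rewrite /= /W /= addrK.
by rewrite /= /W /= subr0.
Qed.

Lemma frac_eqv_refl F : frac_eqv F F.
Proof. exact: frac_ext. Qed.
Lemma frac_eqv_sym F G : frac_eqv F G -> frac_eqv G F.
Proof. by move=> [H [HF HG]]; exists H. Qed.
Lemma frac_eqv_trans F G H : frac_eqv F G -> frac_eqv G H -> frac_eqv F H.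
Proof.
move=> /frac_eqvP LFG /frac_eqvP LGH; apply/frac_eqvP.
pose W (p : Y * quot_lmod (gdom G)) := exists x y y',
  [/\ F (x, y), H (x, y'), p.1 = y - y' & p.2 = qcl (gdom G) x].
have w0 : W 0.
  exists 0, 0, 0; rewrite subrr raddf0.
  by split=> //; [exact: (smem0 F)|exact: (smem0 H)].
have wP a p q : W p -> W q -> W (a *: p + q).
  move=> [x [y [y' [Fy Gy p1 p2]]]] [u [v [v' [Fv Gv q1 q2]]]].
  exists (a *: x + u), (a *: y + v), (a *: y' + v').
  split; [exact: (smemP a Fy Fv)|exact: (smemP a Gy Gv)| |].
    by rewrite /= p1 q1 scalerBr addrACA -opprD.
  by rewrite qclL -p2 -q2.
pose N (d : Y) := exists y1 y2, [/\ gdiff F G y1, gdiff G H y2 & d = y1 + y2].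
have n0 : N 0 by exists 0, 0; rewrite addr0; split=> //; exact: smem0.
have nP a p q : N p -> N q -> N (a *: p + q).
  move=> [p1 [p2 [D1 D2 ->]]] [q1 [q2 [E1 E2 ->]]].
  exists (a *: p1 + q1), (a *: p2 + q2); split; try exact: smemP.
  by rewrite scalerDr addrACA.
apply: (@loc_sub _ _ (Submodule w0 wP) _ (Submodule n0 nP)) (frac_dom G) _.
- by move=> d [x [y [y' [Fy Hy ->]]]]; exists (qcl (gdom G) x), x, y, y'.
- move=> d _ [x [y [y' [Fy Hy /= -> x0]]]].
  have [z Gz] : gdom G x.
    have /qclP : qcl (gdom G) x = qcl (gdom G) 0 by rewrite raddf0.
    by rewrite subr0.
  exists (y - z), (z - y'); rewrite addrA subrK; split=> //.
    by exists x, y, z.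
  by exists x, z, y'.
- by apply: loc_sum LFG LGH.
Qed.

End Diff.

Section Hom.
Variables X Y : lmodType R.

HB.instance Definition _ := gen_eqMixin (frac X Y).
HB.instance Definition _ := gen_choiceMixin (frac X Y).

Definition frac_eqb : rel (frac X Y) := fun F G => `[< frac_eqv F G >].

Lemma frac_eqb_equiv : equiv_class_of frac_eqb.
Proof.
split=> [F|F G|G F H].
- by apply/asboolP; exact: frac_eqv_refl.
- by apply: asbool_equiv_eq; split; exact: frac_eqv_sym.
- move=> /asboolP FG /asboolP GH; apply/asboolP; exact: frac_eqv_trans GH.
Qed.
Canonical frac_equiv := EquivRelPack frac_eqb_equiv.

Definition gab_hom := {eq_quot frac_eqb}.
Definition gab_cl (F : frac X Y) : gab_hom := \pi F.

Lemma gab_clP F G : gab_cl F = gab_cl G <-> frac_eqv F G.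
Proof. by split=> [/eqmodP/asboolP|FG] //; apply/eqmodP/asboolP. Qed.
Lemma gab_clK (f : gab_hom) : gab_cl (repr f) = f. Proof. exact: reprK. Qed.
End Hom.

Section Comp.
Variables X Y Z : lmodType R.

Definition gcomp (G : submodule (Y * Z)%type) (F : submodule (X * Y)%type) :
  submodule (X * Z)%type.
Proof.
apply: (@Submodule R (X * Z)%type (fun p => exists y, F (p.1, y) /\ G (y, p.2))).
  by exists 0; split; [exact: (smem0 F)|exact: (smem0 G)].
move=> a p q [y [Fy Gy]] [z [Fz Gz]]; exists (a *: y + z).
by split; [exact: (smemP a Fy Fz)|exact: (smemP a Gy Gz)].
Defined.

Lemma gcomp_dom (G : frac Y Z) (F : frac X Y) : L (quot_lmod (gdom (gcomp G F))).
Proof.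
pose W (p : X * quot_lmod (gdom G)) :=
  exists y, F (p.1, y) /\ p.2 = qcl (gdom G) y.
have w0 : W 0 by exists 0; rewrite raddf0; split=> //; exact: (smem0 F).
have wP a p q : W p -> W q -> W (a *: p + q).
  move=> [y [Fy p2]] [z [Fz q2]]; exists (a *: y + z).
  by split; [exact: (smemP a Fy Fz)|rewrite qclL -p2 -q2].
apply: (@loc_dense _ _ (Submodule w0 wP) _ (gdom F)) (frac_dom F) (frac_dom G).
  by move=> x [y Fy]; exists (qcl (gdom G) y), y.
move=> x _ [y [Fy y0]].
have [z Gz] : gdom G y.
  have /qclP : qcl (gdom G) y = qcl (gdom G) 0 by rewrite raddf0.
  by rewrite subr0.
by exists z, y.
Qed.

Lemma gcomp_ind (G : frac Y Z) (F : frac X Y) : L (sub_lmod (gind (gcomp G F))).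
Proof.
pose W (p : Z * sub_lmod (gind F)) := G (smval p.2, p.1).
have w0 : W 0 by exact: (smem0 G).
have wP a p q : W p -> W q -> W (a *: p + q) by exact: (smemP a).
apply: (@loc_sub _ _ (Submodule w0 wP) _ (gind G)) (frac_ind F) (frac_ind G) => z.
  by move=> [y [Fy Gy]]; exists (@smem_sub _ _ (gind F) y Fy).
by [].
Qed.

(* In terms of f : X' -> Y / Y' and g : Y'' -> Z / Z', this is the map *)
(* f^-1((Y'' + Y') / Y') -> Z / Z'' induced by f and g, where Z'' / Z' is *)
(* the image of Y' ∩ Y'' under g. *)
Definition frac_comp (G : frac Y Z) (F : frac X Y) : frac X Z :=
  Frac (gcomp_dom G F) (gcomp_ind G F).

Lemma frac_comp_eqvr (G : frac Y Z) (F F' : frac X Y) :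
  frac_eqv F F' -> frac_eqv (frac_comp G F) (frac_comp G F').
Proof.
move=> /frac_eqvP LD; apply/frac_eqvP.
pose W (p : Z * sub_lmod (gdiff F F')) := G (smval p.2, p.1).
have w0 : W 0 by exact: (smem0 G).
have wP a p q : W p -> W q -> W (a *: p + q) by exact: (smemP a).
apply: (@loc_sub _ _ (Submodule w0 wP) _ (gind G)) LD (frac_ind G) => d.
  move=> [x [z [z' [[y [/= Fy Gy]] [y' [/= Fy' Gy']] ->]]]].
  have Dy : gdiff F F' (y - y') by exists x, y, y'.
  by exists (smem_sub Dy); exact: graph_sub.
by [].
Qed.

Lemma frac_comp_eqvl (G G' : frac Y Z) (F : frac X Y) :
  frac_eqv G G' -> frac_eqv (frac_comp G F) (frac_comp G' F).
Proof.
move=> /frac_eqvP LD; apply/frac_eqvP.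
pose W (p : Z * sub_lmod (gind F)) := exists y z y' z',
  [/\ G (y, z), G' (y', z'), p.1 = z - z' & smval p.2 = y - y'].
have w0 : W 0.
  exists 0, 0, 0, 0; rewrite /= !subrr.
  by split=> //; [exact: (smem0 G)|exact: (smem0 G')].
have wP a p q : W p -> W q -> W (a *: p + q).
  move=> [y [z [y' [z' [Gy Gy' p1 p2]]]]] [u [v [u' [v' [Gu Gu' q1 q2]]]]].
  exists (a *: y + u), (a *: z + v), (a *: y' + u'), (a *: z' + v').
  split; [exact: (smemP a Gy Gu)|exact: (smemP a Gy' Gu')| |].
    by rewrite /= p1 q1 scalerBr addrACA -opprD.
  by rewrite /= p2 q2 scalerBr addrACA -opprD.
apply: (@loc_sub _ _ (Submodule w0 wP) _ (gdiff G G')) (frac_ind F) LD => d.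
  move=> [x [z [z' [[y [/= Fy Gy]] [y' [/= Fy' Gy']] ->]]]].
  have Iy : gind F (y - y') by exact: graph_ind Fy Fy'.
  by exists (@smem_sub _ _ (gind F) _ Iy), y, z, y', z'.
move=> _ [y [z [y' [z' [Gy Gy' /= -> /esym/subr0_eq yy']]]]].
by exists y, z, z'; rewrite {2}yy'.
Qed.

Definition gab_comp (g : gab_hom Y Z) (f : gab_hom X Y) : gab_hom X Z :=
  gab_cl (frac_comp (repr g) (repr f)).

Lemma gab_compE G F : gab_comp (gab_cl G) (gab_cl F) = gab_cl (frac_comp G F).
Proof.
apply/gab_clP; apply: (@frac_eqv_trans _ _ _ (frac_comp G (repr (gab_cl F)))).
  by apply: frac_comp_eqvl; apply/gab_clP; exact: gab_clK.
by apply: frac_comp_eqvr; apply/gab_clP; exact: gab_clK.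
Qed.
End Comp.

Section Linear.
Variables (X Y : lmodType R) (f : {linear X -> Y}).

Definition lin_graph : submodule (X * Y)%type.
Proof.
apply: (@Submodule R (X * Y)%type (fun p => p.2 = f p.1)).
  exact: esym (raddf0 f).
by move=> a p q p2 q2; rewrite [RHS]linearP -p2 -q2.
Defined.
Lemma lin_graph_dom : L (quot_lmod (gdom lin_graph)).
Proof.
apply: loc_zero => q; rewrite -[q]qclK -[RHS](raddf0 (qcl (gdom lin_graph))).
by apply/qclP; exists (f (repr q - 0)).
Qed.
Lemma lin_graph_ind : L (sub_lmod (gind lin_graph)).
Proof.
apply: loc_zero => y; apply: smval_inj.
by have /= -> := smvalP y; rewrite raddf0.
Qed.
Definition lin_frac : frac X Y := Frac lin_graph_dom lin_graph_ind.
End Linear.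

Definition gab_id (X : lmodType R) : gab_hom X X := gab_cl (lin_frac (lmod_id X)).

Lemma gab_compA (X Y Z W : lmodType R) (h : gab_hom Z W) (g : gab_hom Y Z)
    (f : gab_hom X Y) : gab_comp h (gab_comp g f) = gab_comp (gab_comp h g) f.
Proof.
rewrite -[h]gab_clK -[g]gab_clK -[f]gab_clK !gab_compE.
apply/gab_clP/frac_ext => -[x w]; split=> /=.
  by move=> [z [[y [Fy Gy]] Hz]]; exists y; split=> //; exists z.
by move=> [y [Fy [z [Gz Hz]]]]; exists z; split=> //; exists y.
Qed.
Lemma gab_comp1m (X Y : lmodType R) (f : gab_hom X Y) : gab_comp (gab_id Y) f = f.
Proof.
rewrite -[f]gab_clK gab_compE; apply/gab_clP/frac_ext => -[x y]; split=> /=.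
  by move=> [z [Fz ->]].
by move=> Fy; exists y.
Qed.
Lemma gab_compm1 (X Y : lmodType R) (f : gab_hom X Y) : gab_comp f (gab_id X) = f.
Proof.
rewrite -[f]gab_clK gab_compE; apply/gab_clP/frac_ext => -[x y]; split=> /=.
  by move=> [z [-> Fz]].
by move=> Fy; exists x.
Qed.

(* The quotient category Mod_R / L and the canonical functor onto it. *)
Definition gabriel_quotient : category := @Category (lmodType R) gab_hom gab_id
  gab_comp gab_compA gab_comp1m gab_compm1.

Lemma gab_functorM (X Y Z : lmodType R) (g : {linear Y -> Z})
    (f : {linear X -> Y}) :
  gab_cl (lin_frac (lmod_comp g f)) =
  gab_comp (gab_cl (lin_frac g)) (gab_cl (lin_frac f)).
Proof.
rewrite gab_compE; apply/gab_clP/frac_ext => -[x z]; split=> /=.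
  by move=> ->; exists (f x).
by move=> [y [-> ->]].
Qed.

Definition gabriel_functor : functor (lmod_cat R) gabriel_quotient :=
  @Functor (lmod_cat R) gabriel_quotient id
    (fun X Y (f : {linear X -> Y}) => gab_cl (lin_frac f))
    (fun X => erefl) gab_functorM.

End GabrielQuotient.

Definition Ker_Rat (A B : pzRingType) (iota : {rmorphism A -> B})
    (C : bimodule A) (D : coring C) (T : rational_pairing iota D)
    (X : lmodType B^c) : Prop :=
  forall x : Rat T X, x = 0.

(* Main.v *)
Require Import Defs.
From HB Require Import structures.
From mathcomp Require Import all_boot all_algebra.
From mathcomp Require Import boolp.

Set Implicit Arguments.
Unset Strict Implicit.
Unset Printing Implicit Defensive.

(* Write a for the ideal Rat(B_B). Each of the five statements is equivalent *)
(* to the existence of local units: every rational element m of a right      *)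
(* B-module satisfies m e = m for some e in a. Under this condition Rat(M)   *)
(* is {m | m in m a} and K consists of the modules killed by a, whence all   *)
(* five statements by direct computation with units. Conversely, if Rat maps *)
(* surjections to epimorphisms, as it does in (i), (ii) and (iii), then      *)
(* applying it to B -> mB, b |-> m b, gives m = m e with e in a. In (iv) and *)
(* (v), flatness of B/a, resp. purity of a, tested on xB or B/xB gives       *)
(* x in x a for each x in a, so that elements of M a have local units, and   *)
(* the remaining condition puts every rational element, resp. every element  *)
(* of C, in this position.                                                   *)

Import GRing.Theory.
Local Open Scope ring_scope.

(** * Local units *)

(** Everything passes through [local_units]: each rational m lies in m a. [ideal_local_units] is the
    case of elements of a. Units of finitely many elements merge into one ([ideal_common_unit],
    [has_unit_seq]), so a finite sum is treated with a single e.

    Given local units, multiplying by e makes any lift of a rational element rational, whence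
    exactness. Modules in K are killed by a, so a fraction X -> Y induces a genuine map Rat(X) ->
    Rat(Y), and this is H ([gab_rat_functor]). The transposition h |-> (x |-> (y |-> h (x y))) is
    inverted by evaluation at a unit of x. Finally M ⊗ a -> M is injective, so a rational module has
    exactly one coaction of a, namely m |-> m ⊗ e.

    Conversely, (i), (ii) and (iii) reach local units through [Rat_surj_local_units]. In (iv) and
    (v), [flat_ideal_local_units] and [pure_ideal_local_units] give units inside a, which
    [comodule_local_units] and [full_local_units] extend to all rational elements. *)

Section RightModule.
Variables (R : pzRingType) (M : lmodType R^c).

Lemma rscaleBr (x : M) a b : x :* (a - b) = x :* a - x :* b.
Proof. exact: scalerBl. Qed.

Lemma rscale_sumr (x : M) I (s : seq I) (F : I -> R) :
  x :* (\sum_(i <- s) F i) = \sum_(i <- s) x :* F i.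
Proof. exact: scaler_suml. Qed.

Lemma orbit_linear (x : M) : linear (fun b : R^c^o => x :* b).
Proof.
by move=> a b c; rewrite rscaleDr; congr (_ + _); exact: esym (rscaleA x b a).
Qed.

Definition orbit_map (x : M) : {linear R^c^o -> M} :=
  HB.pack (fun b : R^c^o => x :* b)
    (GRing.isLinear.Build R^c R^c^o M _ _ (orbit_linear x)).

Lemma orbit_mapE (x : M) b : orbit_map x b = x :* b.
Proof. by []. Qed.

End RightModule.

Section LocalUnits.
Variables (A B : pzRingType) (iota : {rmorphism A -> B}).
Variables (C : bimodule A) (D : coring C) (T : rational_pairing iota D).

Definition has_unit (M : lmodType B^c) (m : M) : Prop :=
  exists2 e, in_rat_ideal T e & m :* e = m.

Definition local_units : Prop :=
  forall (M : lmodType B^c) (m : M), rational T m -> has_unit m.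

Definition ideal_local_units : Prop :=
  forall x, in_rat_ideal T x -> exists2 e, in_rat_ideal T e & x * e = x.

Lemma rat_ideal_mulr x b : in_rat_ideal T x -> in_rat_ideal T (x * b).
Proof. by move=> ax; exact: (smemZ (S := rat_submodule T B^c^o) b ax). Qed.
Lemma rat_idealD x y :
  in_rat_ideal T x -> in_rat_ideal T y -> in_rat_ideal T (x + y).
Proof. exact: (@smemD _ _ (rat_submodule T B^c^o)). Qed.
Lemma rat_idealB x y :
  in_rat_ideal T x -> in_rat_ideal T y -> in_rat_ideal T (x - y).
Proof.
move=> ax ay; apply: rat_idealD => //.
exact: (@smemN _ _ (rat_submodule T B^c^o)).
Qed.

Lemma local_units_ideal : local_units -> ideal_local_units.
Proof. by move=> U x ax; exact: (U B^c^o x ax). Qed.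

Lemma rational_ideal (M : lmodType B^c) (m : M) e :
  in_rat_ideal T e -> rational T (m :* e).
Proof. by move=> ae; rewrite -orbit_mapE; exact: rational_map. Qed.

Lemma has_unit_rational (M : lmodType B^c) (m : M) : has_unit m -> rational T m.
Proof. by move=> [e ae <-]; exact: rational_ideal. Qed.

Definition ideal_elt e (ae : in_rat_ideal T e) : rat_ideal T :=
  @smem_sub _ _ (rat_submodule T B^c^o) e ae.

Section Common.
Hypothesis P : ideal_local_units.

(** The witness is 1 - (1 - e)(1 - f): e fixes x, and f is a unit of the remainder y - y e, which
    lies in a again. *)
Lemma ideal_common_unit x y : in_rat_ideal T x -> in_rat_ideal T y ->
  exists e, [/\ in_rat_ideal T e, x * e = x & y * e = y].
Proof.
move=> ax ay; have [e ae xe] := P ax.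
have [f af yf] := P (rat_idealB ay (in_rat_ideal_mull y ae)).
exists (e + f - e * f); split.
- by apply: rat_idealB; [exact: rat_idealD|exact: in_rat_ideal_mull].
- by rewrite mulrBr mulrDr mulrA xe addrK.
- by rewrite mulrBr mulrDr mulrA -addrA -mulrBl yf addrC subrK.
Qed.

(** A common unit g of two units serves whatever either of them serves: m g = m e g = m e = m. *)
Lemma has_unit_seq (M : lmodType B^c) (I : eqType) (s : seq I) (F : I -> M) :
  (forall i, i \in s -> has_unit (F i)) ->
  exists2 e, in_rat_ideal T e & forall i, i \in s -> F i :* e = F i.
Proof.
elim: s => [|i s IH] Fs; first by exists 0 => //; exact: rational0.
have [j js|e ae Fe] := IH _; first by apply: Fs; rewrite inE js orbT.
have [e' ae' Fe'] := Fs i (mem_head _ _).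
have [g [ag eg e'g]] := ideal_common_unit ae ae'.
exists g => // j; rewrite inE => /predU1P[->|/Fe js].
  by rewrite -Fe' rscaleA e'g.
by rewrite -js rscaleA eg.
Qed.

Lemma has_unit2 (M N : lmodType B^c) (m : M) (n : N) : has_unit m -> has_unit n ->
  exists e, [/\ in_rat_ideal T e, m :* e = m & n :* e = n].
Proof.
move=> [e ae me] [f af nf]; have [g [ag eg fg]] := ideal_common_unit ae af.
by exists g; split=> //; [rewrite -me rscaleA eg|rewrite -nf rscaleA fg].
Qed.

Lemma has_unit0 (M : lmodType B^c) : has_unit (0 : M).
Proof. by exists 0; [exact: rational0|rewrite rscale0r]. Qed.

Lemma has_unit_mul (M : lmodType B^c) (m : M) x :
  in_rat_ideal T x -> has_unit (m :* x).
Proof. by move=> /P[e ae xe]; exists e; rewrite // rscaleA xe. Qed.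

Lemma has_unit_sum (M : lmodType B^c) (I : eqType) (s : seq I) (F : I -> M) :
  (forall i, i \in s -> has_unit (F i)) -> has_unit (\sum_(i <- s) F i).
Proof.
move=> /has_unit_seq[e ae Fe]; exists e => //.
by rewrite rscale_suml; apply: eq_big_seq.
Qed.

Lemma has_unitP (M : lmodType B^c) b (m n : M) :
  has_unit m -> has_unit n -> has_unit (b *: m + n).
Proof.
move=> [e ae me] /(has_unit2 (has_unit_mul m (rat_ideal_mulr b ae)))[f [af mf nf]].
exists f; rewrite // rscaleDl nf; congr (_ + _).
by rewrite -[b *: m]/(m :* b) -me [m :* e :* b]rscaleA.
Qed.

Definition unit_submodule (M : lmodType B^c) : submodule M :=
  Submodule (has_unit0 M) (@has_unitP M).

End Common.

End LocalUnits.

(** * Exactness and epimorphisms *)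

Lemma qcl_eq0 (R : pzRingType) (M : lmodType R) (S : submodule M) (x : M) :
  qcl S x = 0 <-> S x.
Proof. by rewrite -(raddf0 (qcl S)) qclP subr0. Qed.

Section KerIm.
Variables (R : pzRingType) (X Y : lmodType R) (f : {linear X -> Y}).

Lemma ker0 : f 0 = 0. Proof. exact: raddf0. Qed.
Lemma kerP a x y : f x = 0 -> f y = 0 -> f (a *: x + y) = 0.
Proof. by move=> fx fy; rewrite linearP fx fy scaler0 addr0. Qed.
Definition ker_submodule : submodule X := Submodule ker0 kerP.

Lemma im0 : exists x, 0 = f x. Proof. by exists 0; rewrite raddf0. Qed.
Lemma imP a y z : (exists x, y = f x) -> (exists x, z = f x) ->
  exists x, a *: y + z = f x.
Proof. by move=> [x ->] [x' ->]; exists (a *: x + x'); rewrite linearP. Qed.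
Definition im_submodule : submodule Y := Submodule im0 imP.

Definition im_map (x : X) : sub_lmod im_submodule :=
  @smem_sub _ _ im_submodule (f x) (ex_intro _ x erefl).
Lemma im_map_linear : linear im_map.
Proof. by move=> a x y; apply: smval_inj; rewrite /= linearP. Qed.
HB.instance Definition _ :=
  GRing.isLinear.Build R X (sub_lmod im_submodule) _ im_map im_map_linear.

Lemma im_map_surj z : exists x, z = im_map x.
Proof. by have [x zx] := smvalP z; exists x; exact: smval_inj. Qed.

Lemma short_exact_ker :
  (forall y, exists x, y = f x) -> short_exact (@smval _ _ ker_submodule) f.
Proof.
move=> fsurj; split=> // [|x]; first exact: smval_inj.
split=> [fx|[k ->]]; last exact: (smvalP k).
by exists (@smem_sub _ _ ker_submodule x fx).
Qed.
End KerIm.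

Section Surjections.
Variables (A B : pzRingType) (iota : {rmorphism A -> B}).
Variables (C : bimodule A) (D : coring C) (T : rational_pairing iota D).

(** The parameters of x lie a priori in M. Their tensor dies in M/S ⊗ C, since [alpha] is injective
    for M/S and x b stays in S; right exactness of the tensor product then moves it into S ⊗ C. *)
Lemma rational_sub (M : lmodType B^c) (S : submodule M) (x : sub_lmod S) :
  rational T (smval x) -> rational T x.
Proof.
move=> /rational_tensor[t xt].
have SP (a : A^c) (y z : restrict iota M) :
    S (y : M) -> S (z : M) -> S (a *: y + z : M).
  exact: (@smemP _ _ S (iota a : B^c) y z).
pose S' : submodule (restrict iota M) :=
  @Submodule _ (restrict iota M) _ (smem0 S) SP.
have [|u tu] := @tens_right_exact _ _ S' C t.
  apply: (@alpha_inj _ _ _ _ _ T); apply: funext => b.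
  rewrite alpha_tmap alpha0 -xt; apply/qcl_eq0.
  exact: (smvalP (x :* b)).
have [s us] := tens_sumP u.
pose toS (y : sub_lmod S') : sub_lmod S := smem_sub (smvalP y : S (smval y)).
exists [seq (p.2 : C, toS p.1) | p <- s] => b; apply: smval_inj.
rewrite [LHS]xt tu alpha_tmap us alpha_sum raddf_sum raddf_sum big_map.
by apply: eq_bigr => p _; rewrite alpha_pure.
Qed.

Definition surjective (X Y : Type) (f : X -> Y) := forall y, exists x, y = f x.

(** Cancellation, unlike surjectivity, makes sense in the quotient category and is kept by
    equivalences and left adjoints. *)
Definition epi (E : category) (X Y : E) (f : Defs.hom X Y) : Prop :=
  forall (Z : E) (g h : Defs.hom Y Z), cmp g f = cmp h f -> g = h.

Definition surjections_to_epis (E : category) (F : functor (Mod B) E) : Prop :=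
  forall (X Y : lmodType B^c) (f : {linear X -> Y}), surjective f ->
    epi (fmap F (f : @Defs.hom (Mod B) X Y)).

Lemma Rat_surj_local_units :
  (forall (X Y : lmodType B^c) (f : {linear X -> Y}),
     surjective f -> surjective (Rat_map T f)) -> local_units T.
Proof.
move=> Rs M m rm; pose f := orbit_map m.
have r1 : rational T (im_map f (1 : B)).
  by apply: rational_sub; rewrite /= rscale1.
have [e re] := Rs _ _ (im_map f) (@im_map_surj _ _ _ f)
  (@smem_sub _ _ (rat_submodule T _) _ r1).
exists (smval e); first exact: (smvalP e).
have := congr1 (fun z => smval (smval z)) re.
by rewrite /= rscale1 => <-.
Qed.

(** Epimorphisms of rational modules are surjective: the cokernel is a quotient of a rational
    module, hence an object of [RatMod], and its projection agrees with zero on the image. *)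
Lemma epi_local_units : surjections_to_epis (Rat_functor T) -> local_units T.
Proof.
move=> E; apply: Rat_surj_local_units => X Y f fs y.
pose S := im_submodule (Rat_map T f).
have rW : is_rational T (quot_lmod S).
  by move=> q; rewrite -[q]qclK; apply: rational_map; exact: Rat_is_rational.
pose W : RatMod T := FullOb (rW : (is_rational T : Mod B -> Prop) _).
have q0 := E _ _ f fs W (qcl S) (\0 : {linear _ -> _}).
have /(congr1 (fun h : {linear _ -> _} => h y)) : (qcl S : {linear _ -> _}) = \0.
  apply: q0; apply: linear_eq => x; apply/qcl_eq0.
  by exists x.
by move/qcl_eq0.
Qed.

Lemma exact_local_units : exact_functor (Rat_endofunctor T) -> local_units T.
Proof.
move=> E; apply: Rat_surj_local_units => X Y f fs.
by have [] := E _ _ _ _ _ (short_exact_ker fs).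
Qed.

(** A preimage x of a rational element need not be rational, but x e is, and it is still a preimage
    when e is a unit of that element. *)
Lemma local_units_exact : local_units T -> exact_functor (Rat_endofunctor T).
Proof.
move=> U X Y Z f g [finj fg gsurj]; split=> [x y /(congr1 (@smval _ _ _))|y|z].
- by move=> /finj xy; exact: smval_inj.
- split=> [/(congr1 (@smval _ _ _)) /fg [x yx]|[x ->]]; last first.
    by apply: smval_inj; apply/fg; exists (smval x).
  have [e ae ye] := U _ _ (smvalP y).
  exists (@smem_sub _ _ (rat_submodule T X) (x :* e) (rational_ideal x ae)).
  by apply: smval_inj; rewrite /= linear_rscale -yx ye.
- have [e ae ze] := U _ _ (smvalP z); have [y zy] := gsurj (smval z).
  exists (@smem_sub _ _ (rat_submodule T Y) (y :* e) (rational_ideal y ae)).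
  by apply: smval_inj; rewrite /= linear_rscale -zy ze.
Qed.

End Surjections.

(** * Purity and flatness *)

Lemma tmap_sum (R : pzRingType) (M M' : lmodType R^c) (N N' : lmodType R)
    (f : {linear M -> M'}) (g : {linear N -> N'}) I (s : seq I) F :
  tmap f g (\sum_(i <- s) F i) = \sum_(i <- s) tmap f g (F i).
Proof. exact: (tsum_sum (tmap_balanced f g)). Qed.

Lemma tpure_suml (R : pzRingType) (M : lmodType R^c) (N : lmodType R) I
    (s : seq I) (F : I -> M) (n : N) :
  (\sum_(i <- s) F i) ⊗ n = \sum_(i <- s) F i ⊗ n.
Proof.
apply: (big_morph (fun m : M => m ⊗ n) (op1 := +%R) (id1 := 0)) => [x y|].
  exact: tpureDl.
exact: tpure0l.
Qed.

Lemma tpure_sumr (R : pzRingType) (M : lmodType R^c) (N : lmodType R) I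
    (s : seq I) (F : I -> N) (m : M) :
  m ⊗ (\sum_(i <- s) F i) = \sum_(i <- s) m ⊗ F i.
Proof.
apply: (big_morph (fun n : N => m ⊗ n) (op1 := +%R) (id1 := 0)) => [x y|].
  exact: tpureDr.
exact: tpure0r.
Qed.

Lemma tmap0 (R : pzRingType) (M M' : lmodType R^c) (N N' : lmodType R)
    (f : {linear M -> M'}) (g : {linear N -> N'}) : tmap f g 0 = 0.
Proof. exact: (tsum0 (tmap_balanced f g)). Qed.

Lemma tmap_inj (R : pzRingType) (M M' : lmodType R^c) (N N' : lmodType R)
    (f : {linear M -> M'}) (g : {linear N -> N'}) :
  (forall t, tmap f g t = 0 -> t = 0) -> injective (tmap f g).
Proof.
move=> inj t u tu; apply/eqP; rewrite -subr_eq0; apply/eqP/inj.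
by apply: (addIr (tmap f g u)); rewrite -tmapD subrK add0r.
Qed.

Lemma lorbit_linear (R : pzRingType) (N : lmodType R) (n : N) :
  linear (fun b : R^o => (b : R) *: n).
Proof. by move=> a b c; rewrite scalerDl -scalerA. Qed.

Definition lorbit_map (R : pzRingType) (N : lmodType R) (n : N) :
    {linear R^o -> N} :=
  HB.pack (fun b : R^o => (b : R) *: n)
    (GRing.isLinear.Build R R^o N _ _ (lorbit_linear n)).

Lemma scale_qcl1 (R : pzRingType) (S : submodule R^o) (r : R) :
  S r -> r *: qcl S 1 = 0.
Proof.
by move=> Sr; rewrite -linearZ; apply/qcl_eq0; rewrite /GRing.scale /= mulr1.
Qed.

Section FlatPure.
Variables (A B : pzRingType) (iota : {rmorphism A -> B}).
Variables (C : bimodule A) (D : coring C) (T : rational_pairing iota D).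

Local Notation a := (rat_left_ideal T).

(** Right multiplication by a common unit of the second factors of t is a left linear map B -> a
    fixing these factors, so it recovers t from its image in M ⊗ B. *)
Lemma ideal_local_units_pure : ideal_local_units T -> pure a.
Proof.
move=> P M; apply: tmap_inj => t t0; have [s ts] := tens_sumP t.
have [|e ae xe] := @has_unit_seq _ _ _ _ _ T P B^c^o _ s (fun p => smval p.2).
  by move=> p _; have [f af pf] := P _ (smvalP p.2); exists f.
pose e' : sub_lmod a := @smem_sub _ _ a e ae.
suff -> : t = tmap idfun (lorbit_map e') (tmap idfun (@smval _ _ a) t).
  by rewrite t0 tmap0.
rewrite ts (tmap_sum (lmod_id M) (@smval _ _ a)).
rewrite (tmap_sum (lmod_id M) (lorbit_map e')).
apply: eq_big_seq => p ps; rewrite !tmap_pure.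
by congr (_ ⊗ _); apply: smval_inj; rewrite /= -[LHS](xe p ps).
Qed.

(** Every tensor in M ⊗ B/a is some m ⊗ 1. If f m ⊗ 1 = 0, then f m has a unit e, so m e = m by
    injectivity of f, and m ⊗ 1 = m ⊗ e = 0. *)
Lemma ideal_local_units_flat : ideal_local_units T -> flat (quot_lmod a).
Proof.
move=> P M N f finj; apply: tmap_inj => t t0.
(* Under [P] this is N a, so that n ⊗ b |-> n b modulo S is well defined on N ⊗ B/a. *)
pose S := unit_submodule P N.
have SE n (b b' : B) : qcl a b = qcl a b' -> qcl S (n :* b) = qcl S (n :* b').
  by move=> /qclP bb'; apply/qclP; rewrite -rscaleBr; exact: has_unit_mul.
pose g (n : N) (q : quot_lmod a) := qcl S (n :* (repr q : B)).
have gE n b : g n (qcl a b) = qcl S (n :* b) by apply: SE; exact: qclK.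
have bg : balanced g.
  split=> [n n' q|n q q'|n b q].
  - by rewrite /g rscaleDl raddfD.
  - by rewrite -[q]qclK -[q']qclK -raddfD !gE -raddfD -rscaleDr.
  - by rewrite -[q]qclK -linearZ !gE rscaleA.
have [m tm] : exists m, t = m ⊗ qcl a 1.
  have [s ->] := tens_sumP t; exists (\sum_(p <- s) p.1 :* (repr p.2 : B)).
  rewrite tpure_suml.
  apply: eq_bigr => p _; rewrite tpure_bal -linearZ; congr (_ ⊗ _).
  by rewrite -[LHS]qclK; congr (qcl a _); rewrite /GRing.scale /= mulr1.
have : tsum g (tmap f idfun t) = 0 by rewrite t0 tsum0.
rewrite tm tmap_pure (tsum_pure bg) gE rscale1 => /qcl_eq0[e ae fe].
have /finj <- : f (m :* e) = f m by rewrite linear_rscale.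
by rewrite tpure_bal scale_qcl1 // tpure0r.
Qed.

Definition mul_ideal (x : B) : submodule B^c^o :=
  im_submodule
    (lmod_comp (orbit_map (x : B^c^o)) (@smval _ _ (rat_submodule T B^c^o))).

Lemma mul_idealP x y : mul_ideal x y -> exists2 e, in_rat_ideal T e & x * e = y.
Proof. by move=> [e ->]; exists (smval e) => //; exact: (smvalP e). Qed.

Lemma mul_idealI x e : in_rat_ideal T e -> mul_ideal x (x * e).
Proof. by move=> ae; exists (@smem_sub _ _ (rat_submodule T B^c^o) e ae). Qed.

(** Flatness is tested on the inclusion of xB in B: x ⊗ 1 becomes 1 ⊗ x = 0 in B ⊗ B/a, so it
    vanishes in xB ⊗ B/a already. The multiplication [g] into B/xa then puts x in xa. *)
Lemma flat_ideal_local_units : flat (quot_lmod a) -> ideal_local_units T.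
Proof.
move=> F x ax; pose f := orbit_map (x : B^c^o); pose S := mul_ideal x.
have SE (y : sub_lmod (im_submodule f)) (b b' : B) : qcl a b = qcl a b' ->
    qcl S (smval y :* b) = qcl S (smval y :* b').
  move=> /qclP bb'; apply/qclP; rewrite -rscaleBr.
  have [z ->] := smvalP y; rewrite [f z]orbit_mapE rscaleA.
  by apply: mul_idealI; exact: in_rat_ideal_mull.
pose g (y : sub_lmod (im_submodule f)) (q : quot_lmod a) :=
  qcl S (smval y :* (repr q : B)).
have gE y b : g y (qcl a b) = qcl S (smval y :* b) by apply: SE; exact: qclK.
have bg : balanced g.
  split=> [n n' q|n q q'|n b q].
  - by rewrite /g (raddfD (@smval _ _ _)) rscaleDl raddfD.
  - by rewrite -[q]qclK -[q']qclK -raddfD !gE -raddfD -rscaleDr.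
  - by rewrite -[q]qclK -linearZ !gE; congr (qcl S _); exact: rscaleA (smval n) b _.
pose x1 := im_map f (1 : B).
have x10 : x1 ⊗ qcl a 1 = 0.
  apply: (F _ _ (@smval _ _ (im_submodule f))); first exact: smval_inj.
  rewrite tmap0 tmap_pure /= -[x in x :* 1]mul1r -[_ * x]/((1 : B^c^o) :* x).
  by rewrite rscaleA tpure_bal mulr1 scale_qcl1 // tpure0r.
have : tsum g (x1 ⊗ qcl a 1) = 0 by rewrite x10 tsum0.
rewrite (tsum_pure bg) gE rscale1 => /qcl_eq0.
by rewrite [smval x1](mulr1 x) => /mul_idealP.
Qed.

(** Purity is tested on B/xB: 1 ⊗ x in B/xB ⊗ a becomes x ⊗ 1 = 0 in B/xB ⊗ B, so it is zero. The
    multiplication [g] into B/xa then puts x in xa. *)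
Lemma pure_ideal_local_units : pure a -> ideal_local_units T.
Proof.
move=> F x ax; pose f := orbit_map (x : B^c^o); pose S := mul_ideal x.
pose Q := quot_lmod (im_submodule f).
have SE (y : sub_lmod a) (b b' : B^c^o) :
    qcl (im_submodule f) b = qcl (im_submodule f) b' ->
    qcl S (b :* (smval y : B)) = qcl S (b' :* (smval y : B)).
  move=> /qclP [z bb']; apply/qclP.
  have -> : b :* (smval y : B) - b' :* (smval y : B) = x * ((z : B) * smval y).
    by rewrite mulrA -[x * z]bb'; exact: esym (@mulrBl B (smval y) b b').
  by apply: mul_idealI; apply: in_rat_ideal_mull; exact: (smvalP y).
pose g (q : Q) (y : sub_lmod a) := qcl S ((repr q : B^c^o) :* (smval y : B)).
have gE b y : g (qcl _ b) y = qcl S (b :* (smval y : B)).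
  by apply: SE; exact: qclK.
have bg : balanced g.
  split=> [q q' y|q y y'|q b y].
  - by rewrite -[q]qclK -[q']qclK -raddfD !gE -raddfD -rscaleDl.
  - by rewrite /g raddfD rscaleDr raddfD.
  - rewrite -[q]qclK -linear_rscale !gE; congr (qcl S _).
    exact: (rscaleA (repr q : B^c^o) b _).
pose y : sub_lmod a := @smem_sub _ _ a x ax.
have y0 : qcl (im_submodule f) (1 : B^c^o) ⊗ y = 0.
  apply: F; rewrite tmap0 tmap_pure /= -[x in _ ⊗ x]mulr1.
  rewrite -[x * 1]/(x *: (1 : B^o)) -tpure_bal.
  have -> : qcl (im_submodule f) (1 : B^c^o) :* x = 0; last exact: tpure0l.
  rewrite -linear_rscale; apply/qcl_eq0; exists (1 : B^c^o).
  by rewrite orbit_mapE rscale1; exact: (@mul1r B).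
have : tsum g (qcl (im_submodule f) (1 : B^c^o) ⊗ y) = 0 by rewrite y0 tsum0.
rewrite (tsum_pure bg) gE => /qcl_eq0/mul_idealP [e ae xe].
by exists e => //; rewrite xe; exact: (@mul1r B).
Qed.

Lemma ideal_local_units_idempotent :
  ideal_local_units T -> rat_ideal_idempotent T.
Proof.
move=> P x; split=> [ax|[s [sa ->]]].
  have [e ae xe] := P x ax; exists [:: (x, e)]; rewrite big_seq1.
  by split=> // p; rewrite inE => /eqP ->.
rewrite big_seq; elim/big_ind: _ => [|y z|p /sa[]].
- exact: rational0.
- exact: rat_idealD.
- by move=> _ a2; exact: in_rat_ideal_mull.
Qed.

Definition coring_comodule : comodule D := Comodule (deltaA D) (counitr D).

Lemma local_units_full : local_units T -> coring_rat_ideal_full T.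
Proof.
move=> U c; have [e ae ce] := U _ _ (@comod_mod_rational _ _ _ _ _ T coring_comodule c).
exists [:: (c, e)]; rewrite big_seq1.
by split=> [p|]; [rewrite inE => /eqP ->|exact: esym ce].
Qed.

(** If e is a common unit of the c_i in rational parameters (c_i, m_i) of m, then m e = sum m_i
    <c_i, e> = sum m_i <c_i e, 1> = sum m_i <c_i, 1> = m. *)
Lemma full_local_units :
  ideal_local_units T -> coring_rat_ideal_full T -> local_units T.
Proof.
move=> P full M m [s ms].
have cu (c : comod_mod T coring_comodule) : has_unit T c.
  have [r [ra ->]] := full c; apply: (has_unit_sum P) => p /ra ap.
  exact: (has_unit_mul P (p.1 : comod_mod T coring_comodule) ap).
have [|e ae ce] := @has_unit_seq _ _ _ _ _ T P
  (comod_mod T coring_comodule) _ s (fun p => p.1).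
  by move=> p _; exact: cu.
exists e => //; rewrite ms -[RHS]rscale1 ms; apply: eq_big_seq => p ps.
rewrite -[in RHS](ce p ps); congr (_ :* iota _).
by rewrite -[e in LHS]mulr1; exact: esym (pair_coring_rscale _ _ _ _).
Qed.

End FlatPure.

(** * The quotient category *)

Lemma functor_eq (E E' : category) (o : E -> E')
    (m m' : forall X Y, Defs.hom X Y -> Defs.hom (o X) (o Y)) m1 mM m1' mM' :
  (forall X Y f, m X Y f = m' X Y f) ->
  @Functor E E' o m m1 mM = @Functor E E' o m' m1' mM'.
Proof.
move=> mm'; have {}mm' : m = m' by do 3!apply: functional_extensionality_dep => ?.
by subst m'; congr Functor; exact: Prop_irrelevance.
Qed.

Section Gabriel.
Variables (A B : pzRingType) (iota : {rmorphism A -> B}).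
Variables (C : bimodule A) (D : coring C) (T : rational_pairing iota D).

Local Notation K := (Ker_Rat T).

Lemma Ker_RatP (X : lmodType B^c) : K X <-> forall x : X, rational T x -> x = 0.
Proof.
split=> [KX x rx|KX x].
  by have := congr1 (@smval _ _ _) (KX (@smem_sub _ _ (rat_submodule T X) x rx)).
by apply: smval_inj; apply: KX; exact: (smvalP x).
Qed.

Section FromLocalUnits.
Hypothesis U : local_units T.

Lemma Ker_Rat_ideal (X : lmodType B^c) :
  K X <-> forall (x : X) e, in_rat_ideal T e -> x :* e = 0.
Proof.
rewrite Ker_RatP; split=> [KX x e ae|KX x /U[e ae <-]]; last exact: KX.
by apply: KX; exact: rational_ideal.
Qed.

Lemma annihilator0 (X : lmodType B^c) e : in_rat_ideal T e -> (0 : X) :* e = 0.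
Proof. by rewrite rscale0l. Qed.
Lemma annihilatorP (X : lmodType B^c) b (x y : X) :
  (forall e, in_rat_ideal T e -> x :* e = 0) ->
  (forall e, in_rat_ideal T e -> y :* e = 0) ->
  forall e, in_rat_ideal T e -> (b *: x + y) :* e = 0.
Proof.
move=> x0 y0 e ae; rewrite rscaleDl y0 // addr0 [LHS](rscaleA x b e).
by apply: x0; exact: in_rat_ideal_mull.
Qed.
Definition annihilator (X : lmodType B^c) : submodule X :=
  Submodule (@annihilator0 X) (@annihilatorP X).

(** Coproducts are known only by their universal property: the projection of Y modulo the
    annihilator of a agrees with zero on every summand, hence is zero. For an extension write e = e
    e' in a: the factor e moves y into X, and e' kills it there. *)
Lemma Ker_Rat_localizing : localizing K.
Proof.
split=> [I X Y inj cop KX|X Y Z f g [finj fg gsurj]].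
  apply/Ker_Rat_ideal => y; pose S := annihilator Y.
  pose Q : lmodType B^c := quot_lmod S.
  have [h [_ hu]] := cop Q (fun i => \0 : {linear (X i : lmodType B^c) -> Q}).
  apply/(qcl_eq0 S); transitivity (h y); last first.
    have -> // : h = (\0 : {linear (Y : lmodType B^c) -> Q}).
    by apply: hu => i; exact: linear_eq.
  have -> // : h = (qcl S : {linear (Y : lmodType B^c) -> Q}).
  apply: hu => i; apply: linear_eq => x; apply/qcl_eq0 => e ae.
  by rewrite -linear_rscale (proj1 (Ker_Rat_ideal _) (KX i)) // raddf0.
rewrite !Ker_Rat_ideal; split=> [KY|[KX KZ] y e ae].
  split=> [x e ae|z e ae]; first by apply: finj; rewrite linear_rscale KY // raddf0.
  by have [y ->] := gsurj z; rewrite -linear_rscale KY // raddf0.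
have [e' ae' ee'] := local_units_ideal U ae.
have [x yx] := proj1 (fg (y :* e)) (etrans (linear_rscale g y e) (KZ _ _ ae)).
by rewrite -ee' -rscaleA yx -linear_rscale KX // raddf0.
Qed.

Let hL := Ker_Rat_localizing.

Section FracRat.
Variables (X Y : lmodType B^c).
Implicit Types F G : Defs.frac K X Y.

(** X modulo the domain of F is killed by a, so x = x e lies in the domain; multiplying the pair by
    e makes the value rational as well. *)
Lemma frac_rat_total F (x : X) : rational T x ->
  exists y, rational T y /\ F (x, y).
Proof.
move=> /U[e ae xe].
have /qcl_eq0[y Fy] : qcl (gdom F) x = 0.
  rewrite -xe linear_rscale.
  exact: (proj1 (Ker_Rat_ideal _) (frac_dom F)).
exists (y :* e); split; first exact: rational_ideal.
by rewrite -xe; exact: (@smemZ _ _ F e (x, y)).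
Qed.

Lemma frac_rat_uniq F (x y y' : _) : rational T y -> rational T y' ->
  F (x, y) -> F (x, y') -> y = y'.
Proof.
move=> ry ry' Fy Fy'; apply: subr0_eq.
have rd : rational T (y - y').
  exact: (@smemD _ _ (rat_submodule T Y) _ _ ry (@smemN _ _ (rat_submodule T Y) _ ry')).
pose d : sub_lmod (gind F) := @smem_sub _ _ (gind F) _ (graph_ind Fy Fy').
have := proj1 (Ker_RatP _) (frac_ind F) d (@rational_sub _ _ _ _ _ T _ (gind F) d rd).
by move/(congr1 (@smval _ _ _)).
Qed.

Lemma frac_rat_subproof F (x : Defs.Rat T X) : exists y : Defs.Rat T Y, F (smval x, smval y).
Proof.
have [y [ry Fy]] := frac_rat_total F (smvalP x).
by exists (@smem_sub _ _ (rat_submodule T Y) y ry).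
Qed.

(* The quotient category does not see modules killed by the ideal, so a *)
(* fraction is an honest map on the rational parts. *)
Definition frac_rat F (x : Defs.Rat T X) : Defs.Rat T Y :=
  projT1 (cid (frac_rat_subproof F x)).

Lemma frac_ratP F x : F (smval x, smval (frac_rat F x)).
Proof. by rewrite /frac_rat; case: cid. Qed.

Lemma frac_ratE F x y : F (smval x, smval y) -> frac_rat F x = y.
Proof.
move=> Fy; apply: smval_inj.
exact: frac_rat_uniq (smvalP (frac_rat F x)) (smvalP y) (frac_ratP F x) Fy.
Qed.

Lemma frac_rat_linear F : linear (frac_rat F).
Proof.
move=> b x y; apply: frac_ratE.
exact: (smemP b (frac_ratP F x) (frac_ratP F y)).
Qed.
HB.instance Definition _ F :=
  GRing.isLinear.Build B^c (Defs.Rat T X) (Defs.Rat T Y) _ (frac_rat F) (frac_rat_linear F).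

Lemma frac_rat_eqv F G : frac_eqv F G -> frac_rat F =1 frac_rat G.
Proof.
move=> [H [HF HG]] x.
have dx : gdom H (smval x) by exists (smval (frac_rat H x)); exact: frac_ratP.
transitivity (frac_rat H x).
  by symmetry; apply: frac_ratE; apply: (proj2 (HF _ dx)); exact: frac_ratP.
by apply: frac_ratE; apply: (proj2 (HG _ dx)); exact: frac_ratP.
Qed.

Definition gab_rat (f : gab_hom hL X Y) : {linear Defs.Rat T X -> Defs.Rat T Y} :=
  frac_rat (repr f).

Lemma gab_ratE F : gab_rat (gab_cl hL F) =1 frac_rat F.
Proof. by apply: frac_rat_eqv; apply/gab_clP; exact: gab_clK. Qed.

End FracRat.

Lemma gab_rat1 (X : lmodType B^c) : gab_rat (gab_id hL X) = lmod_id (Defs.Rat T X).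
Proof. by apply: linear_eq => x; rewrite gab_ratE; exact: frac_ratE. Qed.

Lemma gab_ratM (X Y Z : lmodType B^c) (g : gab_hom hL Y Z) (f : gab_hom hL X Y) :
  gab_rat (gab_comp g f) = lmod_comp (gab_rat g) (gab_rat f).
Proof.
apply: linear_eq => x; rewrite gab_ratE; apply: frac_ratE.
by exists (smval (gab_rat f x)); split; exact: frac_ratP.
Qed.

Definition gab_rat_functor : functor (gabriel_quotient hL) (RatMod T) :=
  @Functor (gabriel_quotient hL) (RatMod T)
    (fun X => FullOb (@Rat_is_rational _ _ _ _ _ T X)) gab_rat gab_rat1 gab_ratM.

Lemma gab_rat_functorE :
  Rat_functor T = comp_functor gab_rat_functor (gabriel_functor hL).
Proof.
apply: functor_eq => X Y f; apply: linear_eq => x /=.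
by rewrite gab_ratE; symmetry; exact: frac_ratE.
Qed.

Section RatIso.
Variable X : lmodType B^c.

Definition rat_incl : {linear Defs.Rat T X -> X} := @smval _ _ (rat_submodule T X).

(** The converse relation of the inclusion Rat(X) -> X. It is a fraction because X / Rat(X) is
    killed by a, and it inverts the inclusion in the quotient category. *)
Definition rat_graph : submodule (X * Defs.Rat T X)%type.
Proof.
apply: (@Submodule B^c (X * Defs.Rat T X)%type (fun p => p.1 = smval p.2)) => //.
by move=> b p q p1 q1; rewrite /= p1 q1.
Defined.

Lemma rat_graph_dom : K (quot_lmod (gdom rat_graph)).
Proof.
apply/Ker_Rat_ideal => q e ae; rewrite -[q]qclK -linear_rscale.
apply/qcl_eq0; have re := rational_ideal (repr q) ae.
by exists (@smem_sub _ _ (rat_submodule T X) _ re).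
Qed.

Lemma rat_graph_ind : K (sub_lmod (gind rat_graph)).
Proof.
move=> x; apply: smval_inj; apply: smval_inj; apply: smval_inj.
exact: esym (smvalP (smval x)).
Qed.

Definition rat_frac : Defs.frac K X (Defs.Rat T X) := Defs.Frac rat_graph_dom rat_graph_ind.

Lemma rat_incl_iso :
  @is_iso (gabriel_quotient hL) _ _
    (fmap (gabriel_functor hL) (rat_incl : @Defs.hom (Mod B) _ _)).
Proof.
exists (gab_cl hL rat_frac); split; rewrite /= gab_compE; apply/gab_clP.
  apply: frac_ext => -[r r']; split=> [[x [/= -> /smval_inj]]|/= ->] //.
  by exists (smval r).
(* This composite is the identity with domain cut down to Rat(X), so it refines the identity. *)
exists (frac_comp hL (lin_frac hL rat_incl) rat_frac); split=> x [y Fxy].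
  by split=> //; exists y.
by split=> [|z /= ->]; [exists x|case: Fxy => r [/= xr _]; exists r].
Qed.
End RatIso.

Lemma gab_rat_equivalence : equivalence gab_rat_functor.
Proof.
exists (comp_functor (gabriel_functor hL) (RatMod_incl T)); split.
  exists (fun X => fmap (gabriel_functor hL) (rat_incl X : @Defs.hom (Mod B) _ _));
    last exact: rat_incl_iso.
  move=> X Y f; rewrite -[f]gab_clK /= !gab_compE; apply/gab_clP.
  (* This side of the naturality square contains, as a relation, the other one, which is defined on
     all of Rat(X); so it refines both. *)
  exists (frac_comp hL (repr f) (lin_frac hL (rat_incl X))).
  rewrite gab_clK.
  split=> x [y Fxy]; split=> //; try by exists y.
    by exists (smval (gab_rat f x)), (gab_rat f x).
  move=> z [r [/= -> ->]]; exists (smval x); split=> //; exact: frac_ratP.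
pose GM (M : RatMod T) : RatMod T :=
  comp_functor gab_rat_functor (comp_functor (gabriel_functor hL) (RatMod_incl T)) M.
exists (fun M => rat_incl (full_val M) : @Defs.hom (RatMod T) (GM M) M) => [M N f|M].
  apply: linear_eq => x /=.
  have -> : gab_rat (gab_cl hL (lin_frac hL f)) x = Rat_map T f x.
    by rewrite gab_ratE; exact: frac_ratE.
  by [].
pose N : lmodType B^c := full_val M.
pose h (m : N) : Defs.Rat T N := @smem_sub _ _ (rat_submodule T N) m (full_valP M m).
have hl : linear h by move=> b x y; exact: smval_inj.
exists (HB.pack h (GRing.isLinear.Build _ _ _ _ h hl) : {linear N -> Defs.Rat T N}).
by split; apply: linear_eq => // x; exact: smval_inj.
Qed.

End FromLocalUnits.

(** By [frac_eqvP], fractions are equal when the differences of their values form a module in K. For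
    f onto, every difference for g and h is already one for g f and h f. *)
Lemma gabriel_functor_epi (hL : localizing K) :
  surjections_to_epis (gabriel_functor hL).
Proof.
move=> X Y f fs Z g h; rewrite -[g]gab_clK -[h]gab_clK.
move=> /= /[!gab_compE] /gab_clP /(frac_eqvP hL) LD.
apply/gab_clP/(frac_eqvP hL); apply: (loc_subset hL) LD.
move=> _ [y [z [z' [gz hz ->]]]]; have [x yx] := fs y.
by exists x, z, z'; split=> //; exists y.
Qed.

(** The quasi-inverse G is faithful, and G H f is isomorphic to f, so f can be cancelled after
    applying G. *)
Lemma epi_equivalence (E E' : category) (H : functor E E') X Y (f : Defs.hom X Y) :
  equivalence H -> epi f -> epi (fmap H f).
Proof.
move=> [G [[u un ui] [v vn vi]]] ef Z g h gh.
have faith : forall (P Q : E') (p q : Defs.hom P Q), fmap G p = fmap G q -> p = q.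
  move=> P Q p q pq; have [w [_ vw]] := vi P.
  have := vn _ _ p; have := vn _ _ q; rewrite /= pq => -> /(congr1 (fun r => cmp r w)).
  by rewrite -!cmpA vw !cmpm1.
apply: faith; have [w [wu uw]] := ui Y.
suff: cmp (fmap G g) w = cmp (fmap G h) w.
  by move/(congr1 (fun r => cmp r (u Y))); rewrite -!cmpA wu !cmpm1.
apply: ef; have [w' [_ uw']] := ui X.
have wn : cmp w f = cmp (fmap G (fmap H f)) w'.
  have := un _ _ f => /= /(congr1 (fun r => cmp w (cmp r w'))).
  by rewrite -!cmpA uw' cmpm1 !cmpA wu cmp1m => ->.
by rewrite -!cmpA wn !cmpA -!fmapM gh.
Qed.

Lemma gabriel_local_units (hL : localizing K)
    (H : functor (gabriel_quotient hL) (RatMod T)) :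
  equivalence H -> Rat_functor T = comp_functor H (gabriel_functor hL) ->
  local_units T.
Proof.
move=> eH E; apply: epi_local_units; rewrite E => X Y f fs.
by apply: (epi_equivalence eH); exact: gabriel_functor_epi.
Qed.

End Gabriel.

(** * The right adjoint *)

Lemma adjoint_epi (E E' : category) (F : functor E E') (G : functor E' E)
    (X Y : E) (f : Defs.hom X Y) :
  adjoint F G -> epi f -> epi (fmap F f).
Proof.
move=> [phi [phi_bij phi_nat]] ef Z p q pq.
have nat (h : Defs.hom (F Y) Z) : phi X Z (cmp h (fmap F f)) = cmp (phi Y Z h) f.
  have := phi_nat _ _ _ _ f (idm Z) h.
  by rewrite fmap1 cmp1m => ->; rewrite cmp1m.
by apply: (bij_inj (phi_bij _ _)); apply: ef; rewrite -!nat pq.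
Qed.

Lemma surjective_epi (R : pzRingType) (X Y : Mod R) (f : Defs.hom X Y) :
  surjective (f : {linear (X : lmodType R^c) -> (Y : lmodType R^c)}) -> epi f.
Proof.
move=> fs Z g h gh; apply: linear_eq => y; have [x ->] := fs y.
by move: (congr1 (fun k : {linear (X : lmodType R^c) -> (Z : lmodType R^c)} => k x) gh).
Qed.

Section HomAdjoint.
Variables (A B : pzRingType) (iota : {rmorphism A -> B}).
Variables (C : bimodule A) (D : coring C) (T : rational_pairing iota D).

Lemma adjoint_local_units (G : functor (RatMod T) (Mod B)) :
  adjoint (Rat_functor T) G -> local_units T.
Proof.
move=> adj; apply: epi_local_units => X Y f fs.
by apply: (adjoint_epi adj); exact: surjective_epi.
Qed.

Local Notation a := (rat_ideal T).

Section Act.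
Variable X : lmodType B^c.

Definition rat_act (x : X) (y : a) : Defs.Rat T X :=
  @smem_sub _ _ (rat_submodule T X) (x :* rat_ideal_val y)
    (rational_ideal x (smvalP (y : Defs.Rat T B^c^o))).

Lemma rat_act_linear x : linear (rat_act x).
Proof.
move=> b y z; apply: smval_inj.
exact: (linearP (orbit_map x) b (smval (y : Defs.Rat T B^c^o))).
Qed.
HB.instance Definition _ x :=
  GRing.isLinear.Build B^c a (Defs.Rat T X) _ (rat_act x) (rat_act_linear x).

Section Transpose.
Variables (Y : lmodType B^c) (h : {linear Defs.Rat T X -> Y}).

Definition transpose_fun (x : X) : hom_right a Y := lmod_comp h (rat_act x).

Lemma transpose_linear : linear transpose_fun.
Proof.
move=> b x x'; apply: linear_eq => y /=; rewrite -raddfD; congr (h _).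
apply: smval_inj; rewrite /= rscaleDl; congr (_ + _).
exact: (rscaleA x b).
Qed.
HB.instance Definition _ :=
  GRing.isLinear.Build B^c X (hom_right a Y) _ transpose_fun transpose_linear.
Definition transpose : {linear X -> hom_right a Y} := transpose_fun.
End Transpose.

Section Untranspose.
Hypothesis U : local_units T.
Variables (Y : lmodType B^c) (g : {linear X -> hom_right a Y}).

Lemma hom_mul x b (y : a) :
  (g (x :* b) : {linear a -> Y}) y = (g x : {linear a -> Y}) (lscale b y).
Proof. by rewrite linear_rscale. Qed.

(** For u a common unit of e and f, (g x) e = (g x) (e u) = (g (x e)) u = (g x) u, and likewise for
    f. *)
Lemma hom_unit_indep x e f (ae : in_rat_ideal T e) (af : in_rat_ideal T f) :
  x :* e = x -> x :* f = x ->
  (g x : {linear a -> Y}) (ideal_elt ae) = (g x : {linear a -> Y}) (ideal_elt af).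
Proof.
move=> xe xf; have [u [au eu fu]] := ideal_common_unit (local_units_ideal U) ae af.
transitivity ((g x : {linear a -> Y}) (ideal_elt au)).
  rewrite -[in RHS]xe hom_mul; congr ((g x : {linear a -> Y}) _).
  by apply: smval_inj; exact: esym eu.
rewrite -[in LHS]xf hom_mul; congr ((g x : {linear a -> Y}) _).
by apply: smval_inj; exact: fu.
Qed.

Definition rat_unit (x : Defs.Rat T X) : {e : a | smval x :* rat_ideal_val e = smval x}.
Proof.
apply: cid; have [e ae xe] := U (smvalP x).
by exists (ideal_elt ae).
Qed.

Definition untranspose_fun (x : Defs.Rat T X) : Y :=
  (g (smval x) : {linear a -> Y}) (projT1 (rat_unit x)).

Lemma untransposeE (x : Defs.Rat T X) e (ae : in_rat_ideal T e) :
  smval x :* e = smval x ->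
  untranspose_fun x = (g (smval x) : {linear a -> Y}) (ideal_elt ae).
Proof.
rewrite /untranspose_fun; case: rat_unit => f /= xf xe.
rewrite -(hom_unit_indep (smvalP (f : Defs.Rat T B^c^o)) ae xf xe).
by congr ((g (smval x) : {linear a -> Y}) _); exact: smval_inj.
Qed.

Lemma untranspose_linear : linear untranspose_fun.
Proof.
move=> b x y; pose P := local_units_ideal U.
have [e ae xe] := U (smvalP x).
(* A unit of e b is also one of x b = x (e b), so a common unit of e b and y serves x b + y. *)
have ub : has_unit T (e * b : B^c^o).
  by apply: (local_units_ideal U); exact: rat_ideal_mulr.
have [f [af ebf yf]] := has_unit2 P ub (U (smvalP y)).
have xb : smval x :* (e * b) = smval x :* b by rewrite -rscaleA xe.
have xbf : (smval x :* b) :* f = smval x :* b by rewrite -xb rscaleA [e * b * f]ebf.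
rewrite (@untransposeE _ f af); last by rewrite /= rscaleDl yf [X in X + _]xbf.
rewrite (untransposeE ae xe) (untransposeE af yf).
rewrite [g _]linearP; congr (_ + _).
rewrite -[RHS]/((g (smval x) : {linear a -> Y}) (ideal_elt ae) :* b) -linear_rscale.
rewrite -[LHS]/((g (smval x) : {linear a -> Y}) (@lscale B a b (ideal_elt af))).
rewrite -hom_mul -xb hom_mul; congr ((g (smval x) : {linear a -> Y}) _).
exact: smval_inj.
Qed.
HB.instance Definition _ :=
  GRing.isLinear.Build B^c (Defs.Rat T X) Y _ untranspose_fun untranspose_linear.
Definition untranspose : {linear Defs.Rat T X -> Y} := untranspose_fun.
End Untranspose.

Section TransposeK.
Hypothesis U : local_units T.
Variable Y : lmodType B^c.

Lemma transposeK (h : {linear Defs.Rat T X -> Y}) : untranspose U (transpose h) = h.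
Proof.
apply: linear_eq => x; have [e ae xe] := U (smvalP x).
rewrite [LHS](untransposeE U _ ae xe); congr (h _).
exact: smval_inj.
Qed.

Lemma untransposeK (g : {linear X -> hom_right a Y}) : transpose (untranspose U g) = g.
Proof.
apply: linear_eq => x; apply: linear_eq => y.
have [e ae ye] := local_units_ideal U (smvalP (y : Defs.Rat T B^c^o)).
rewrite -[LHS]/(untranspose_fun U g (rat_act x y)) (untransposeE U _ ae); last first.
  by rewrite /= rscaleA; congr (_ :* _).
rewrite hom_mul; congr ((g x : {linear a -> Y}) _); exact: smval_inj.
Qed.
End TransposeK.
End Act.

Lemma local_units_adjoint : local_units T ->
  adjoint (Rat_functor T) (comp_functor (hom_functor a) (RatMod_incl T)).
Proof.
move=> U; exists (fun (X : Mod B) (Y : RatMod T) => @transpose X (full_val Y)); split.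
  move=> X Y; exists (@untranspose X U (full_val Y)); first exact: transposeK.
  exact: untransposeK.
move=> X X' Y Y' f g h; apply: linear_eq => x; apply: linear_eq => y /=.
by congr (g (h _)); apply: smval_inj; exact: linear_rscale.
Qed.

End HomAdjoint.

(** * Comodules over C *)

(* An isomorphism of categories is bijective on objects up to equality, so *)
(* equal modules whose scaling operations are only extensionally equal have *)
(* to be identified: [relmod s] is M with its scaling replaced by s. *)
Definition relmod (R : pzRingType) (M : lmodType R)
    (s : GRing.Nmodule_isLSemiModule R M) : lmodType R :=
  @GRing.Lmodule.Pack R M
    (@GRing.Lmodule.Class R M _ _ _
      (GRing.Lmodule.Algebra_BaseZmoduleNmodule_isZmodule_mixin (GRing.Lmodule.class M))
      _ _ _ _ _ s).

Lemma lmod_mixin_eq (R : pzSemiRingType) V m1 m2 m3 m4 m5 m6 m7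
    (s s' : @GRing.Nmodule_isLSemiModule.axioms_ R V m1 m2 m3 m4 m5 m6 m7) :
  GRing.Nmodule_isLSemiModule.scale s = GRing.Nmodule_isLSemiModule.scale s' ->
  s = s'.
Proof.
case: s s' => s p1 p2 p3 p4 p5 [s' q1 q2 q3 q4 q5] /= ss'; subst s'.
by congr GRing.Nmodule_isLSemiModule.Axioms_; exact: Prop_irrelevance.
Qed.

Lemma relmod_eq (R : pzRingType) (M : lmodType R)
    (s : GRing.Nmodule_isLSemiModule R M) :
  (forall b x, GRing.Nmodule_isLSemiModule.scale s b x = b *: x) ->
  s = GRing.Lmodule.GRing_Nmodule_isLSemiModule_mixin (GRing.Lmodule.class M).
Proof.
by move=> ss0; apply: lmod_mixin_eq; apply/funext => b; apply/funext => x; exact: ss0.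
Qed.

Lemma relmodE (R : pzRingType) (M : lmodType R)
    (s : GRing.Nmodule_isLSemiModule R M) :
  (forall b x, GRing.Nmodule_isLSemiModule.scale s b x = b *: x) -> relmod s = M.
Proof. by move=> /relmod_eq ->; case: M s => V [] *. Qed.

Lemma full_ob_eq (E : category) (P : E -> Prop) (X Y : full_ob P) :
  full_val X = full_val Y -> X = Y.
Proof.
case: X Y => X pX [Y pY] /= XY; subst Y.
by rewrite (Prop_irrelevance pX pY).
Qed.

Section TAssocSum.
Variables (R : pzRingType) (M : lmodType R^c) (P Q : bimodule R).

Lemma tassoc0 :
  tassoc (0 : tens_right (tens_right M P) Q) = 0 :> tensor M (bim_left (tens_bim P Q)).
Proof. exact: (tsum0 (tassoc_balanced M P Q)). Qed.

Lemma tassoc_sum I (s : seq I) (F : I -> tens_right (tens_right M P) Q) :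
  tassoc (\sum_(i <- s) F i) =
    \sum_(i <- s) tassoc (F i) :> tensor M (bim_left (tens_bim P Q)).
Proof. exact: (tsum_sum (tassoc_balanced M P Q)). Qed.
End TAssocSum.

Section Comodules.
Variables (A B : pzRingType) (iota : {rmorphism A -> B}).
Variables (C : bimodule A) (D : coring C) (T : rational_pairing iota D).

(** Serves to identify a comodule with the one rebuilt from its B-module, whose A-scaling is
    restricted from B; the coactions are compared through the injective [alpha]. *)
Lemma comodule_relmod_eq (N : lmodType A^c) (s : GRing.Nmodule_isLSemiModule A^c N)
    (r : {linear relmod s -> tens_right (relmod s) C}) rA r1
    (r' : {linear N -> tens_right N C}) rA' r1' :
  (forall b x, GRing.Nmodule_isLSemiModule.scale s b x = b *: x) ->
  (forall (m : N) b, alpha T (r m) b = alpha T (r' m) b :> N) ->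
  @Comodule _ _ D (relmod s) r rA r1 = @Comodule _ _ D N r' rA' r1'.
Proof.
move=> /relmod_eq E; subst s.
case: N r rA r1 r' rA' r1' => V [m1 m2 m3 m4 m5 m6 m7 m8 m9 s] r rA r1 r' rA' r1' rr0.
have {}rr0 : r = r'.
  by apply: linear_eq => m; apply: (@alpha_inj _ _ _ _ _ T); apply/funext => b; exact: rr0.
by subst r'; congr Comodule; exact: Prop_irrelevance.
Qed.

(* v is a preimage under tassoc of (1 ⊗ delta) t; comparing iterated *)
(* alpha's of v replaces injectivity on N ⊗ (C ⊗ C) in coassociativity. *)
Lemma alpha2_delta (N : lmodType A^c) (t : tensor N (bim_left C)) :
  exists v : tens_right (tens_right N C) C,
    tassoc v = tmap idfun (delta_left D) t /\
    forall b b', alpha T (alpha T v b) b' = alpha T t (b * b').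
Proof.
have [s ->] := tens_sumP t; elim/big_ind: _ => [|t1 t2 [v1 [a1 b1]] [v2 [a2 b2]]|[n c] _ /=].
- exists 0; rewrite tassoc0; split=> [|b b'].
    exact: esym (tmap0 (lmod_id N) (delta_left D)).
  by rewrite !alpha0.
- exists (v1 + v2); rewrite tassocD a1 a2; split=> [|b b'].
    exact: esym (tmapD (lmod_id N) (delta_left D) t1 t2).
  by rewrite !alphaD b1 b2.
have [r cr] := tens_sumP (delta D c).
exists (\sum_(q <- r) ((n ⊗ (q.1 : bim_left C) : tens_right N C) ⊗ q.2)); split=> [|b b'].
  rewrite tassoc_sum.
  rewrite (tmap_pure (lmod_id N) (delta_left D)) /= [delta_left D c]cr.
  rewrite [RHS](@tpure_sumr _ N (bim_left (tens_bim C C))).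
  by apply: eq_bigr => q _; exact: tassoc_pure.
have -> : alpha T (\sum_(q <- r) (n ⊗ (q.1 : bim_left C) : tens_right N C) ⊗ q.2) b =
    \sum_(q <- r) n ⊗ ((q.1 : C) :* T q.2 b : bim_left C).
  by rewrite alpha_sum; apply: eq_bigr => q _; rewrite alpha_pure tens_right_pure.
rewrite alpha_sum alpha_pure -pair_coring_rscale /coring_rscale cr.
rewrite (tsum_sum (coring_rscale_balanced T b)) pair_sum rscale_sumr.
apply: eq_bigr => q _; rewrite (tsum_pure (coring_rscale_balanced T b)).
exact: alpha_pure.
Qed.

Section RationalComodule.
Variables (N : lmodType B^c) (rN : is_rational T N).

Definition rat_coact (m : restrict iota N) : tens_right (restrict iota N) C :=
  projT1 (cid (rational_tensor (rN m))).

Lemma rat_coactP m b : alpha T (rat_coact m) b = (m : N) :* b.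
Proof. by rewrite /rat_coact; case: cid => t /= ->. Qed.

Lemma rat_coact_uniq m (t : tens_right (restrict iota N) C) :
  (forall b, alpha T t b = (m : N) :* b) -> rat_coact m = t.
Proof.
by move=> tm; apply: (@alpha_inj _ _ _ _ _ T); apply/funext => b; rewrite rat_coactP.
Qed.

Lemma rat_coact_linear : linear rat_coact.
Proof.
move=> a m n; apply: rat_coact_uniq => b; rewrite alphaD rat_coactP rscaleDl; congr (_ + _).
rewrite -[a *: rat_coact m]/(rat_coact m :* a) alpha_rscale rat_coactP.
exact: esym (rscaleA (m : N) _ _).
Qed.
HB.instance Definition _ := GRing.isLinear.Build A^c (restrict iota N)
  (tens_right (restrict iota N) C) _ rat_coact rat_coact_linear.

(** Compared before [tassoc], both tensors give m (b b') when evaluated at b and then at b'. *)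
Lemma rat_coactA m : tassoc (tmap rat_coact idfun (rat_coact m)) =
  tmap idfun (delta D : bim_left C -> bim_left (tens_bim C C)) (rat_coact m).
Proof.
have [v [vA vT]] := alpha2_delta (rat_coact m).
rewrite -[RHS]vA; congr tassoc.
apply: (@alpha_inj _ _ _ _ _ T); apply/funext => b.
rewrite alpha_tmap; apply: rat_coact_uniq => b'.
by rewrite vT !rat_coactP rscaleA.
Qed.

Lemma rat_coact1 m :
  tsum (fun (x : restrict iota N) (c : bim_left C) => x :* counit D c) (rat_coact m) = m.
Proof.
rewrite -[RHS](rscale1 (m : N)) -rat_coactP /alpha /tsum.
by apply: eq_bigr => p _; rewrite (pair1 T).
Qed.

Definition rat_comodule : comodule D :=
  Comodule (coact := rat_coact) rat_coactA rat_coact1.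

Lemma comod_mod_rat_comodule : comod_mod T rat_comodule = N :> lmodType B^c.
Proof.
apply: (@relmodE _ N (GRing.Lmodule.GRing_Nmodule_isLSemiModule_mixin
  (GRing.Lmodule.class (comod_mod T rat_comodule : lmodType B^c)))) => b x.
exact: rat_coactP.
Qed.
End RationalComodule.

Lemma rat_comodule_comod_mod (M : comodule D) :
  rat_comodule (@comod_mod_rational _ _ _ _ _ T M) = M.
Proof.
case: M => M r rA r1; set MD := Comodule rA r1.
pose N := rat_comodule (@comod_mod_rational _ _ _ _ _ T MD).
apply: (@comodule_relmod_eq M
  (GRing.Lmodule.GRing_Nmodule_isLSemiModule_mixin (GRing.Lmodule.class (cm_right N)))
  (coact N) (coactA (c := N)) (coact1 (c := N)) r rA r1) => [b x|m b].
  exact: (@comod_mod_iota _ _ _ _ _ T MD).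
exact: (rat_coactP (@comod_mod_rational _ _ _ _ _ T MD)).
Qed.

Section ComodHom.
Variables (M N : comodule D) (f : {linear comod_mod T M -> comod_mod T N}).

Definition comod_fun (m : M) : N := f m.
Lemma comod_fun_linear : linear comod_fun.
Proof.
move=> a m n; transitivity (f ((m : comod_mod T M) :* iota a + n)).
  by congr (f (_ + n)); exact: esym (@comod_mod_iota _ _ _ _ _ T M m a).
rewrite raddfD; congr (_ + _).
transitivity (f m :* iota a); first exact: (linear_rscale f).
exact: (@comod_mod_iota _ _ _ _ _ T N (f m) a).
Qed.
HB.instance Definition _ := GRing.isLinear.Build A^c M N _ comod_fun comod_fun_linear.

Lemma comod_fun_coact m : coact N (comod_fun m) = tmap comod_fun idfun (coact M m).
Proof.
apply: (@alpha_inj _ _ _ _ _ T); apply/funext => b; rewrite alpha_tmap.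
exact: esym (linear_rscale f (m : comod_mod T M) b).
Qed.
Definition comod_hom_of : comod_hom M N := ComodHom comod_fun_coact.
End ComodHom.

Lemma comod_RatMod_iso : iso_of_categories (comod_RatMod T).
Proof.
split=> [|M N].
  exists (fun N : RatMod T => rat_comodule (full_valP N)) => [M|N].
    exact: rat_comodule_comod_mod.
  by apply: full_ob_eq; exact: comod_mod_rat_comodule.
exists (@comod_hom_of M N) => f; first exact: comod_hom_eq.
exact: linear_eq.
Qed.

End Comodules.

(** * Comodules over the ideal *)

Lemma comodule_eq (R : pzRingType) (P : bimodule R) (D : coring P) (M : lmodType R^c)
    (r r' : {linear M -> tens_right M P}) rA r1 rA' r1' :
  r =1 r' -> @Comodule R P D M r rA r1 = @Comodule R P D M r' rA' r1'.
Proof.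
by move=> /linear_eq rr'; subst r'; congr Comodule; exact: Prop_irrelevance.
Qed.

Section IdempotentCoring.
Variables (A B : pzRingType) (iota : {rmorphism A -> B}).
Variables (C : bimodule A) (D : coring C) (T : rational_pairing iota D).

Local Notation a := (rat_ideal T).
Local Notation val := (@rat_ideal_val _ _ _ _ _ T).

Lemma rat_ideal_valP (y : a) : in_rat_ideal T (val y).
Proof. exact: (smvalP (y : Defs.Rat T B^c^o)). Qed.

Section Mul.
Variable M : lmodType B^c.

Definition tmul (t : tens_right M a) : M :=
  tsum (fun (m : M) (y : bim_left a) => m :* val y) t.

Lemma tmul_balanced : balanced (fun (m : M) (y : bim_left a) => m :* val y).
Proof.
split=> [m m' y|m y y'|m b y]; first exact: rscaleDl.
  exact: (rscaleDr m (val y) (val y')).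
by rewrite rscaleA.
Qed.

Lemma tmul_pure m (y : bim_left a) : tmul (m ⊗ y) = m :* val y.
Proof. exact: (tsum_pure tmul_balanced). Qed.

Lemma tmul_sum I (s : seq I) (F : I -> tens_right M a) :
  tmul (\sum_(i <- s) F i) = \sum_(i <- s) tmul (F i).
Proof. exact: (tsum_sum tmul_balanced). Qed.

Lemma tmul_has_unit : ideal_local_units T -> forall t, has_unit T (tmul t).
Proof.
move=> P t; have [s ->] := tens_sumP t; rewrite tmul_sum.
apply: (has_unit_sum P) => p _; rewrite tmul_pure.
by apply: (has_unit_mul P); exact: rat_ideal_valP.
Qed.

(** A common unit e of the second factors makes every tensor simple: m_i ⊗ y_i = m_i ⊗ y_i e = m_i
    y_i ⊗ e. *)
Lemma tmul_unit : ideal_local_units T -> forall t : tens_right M a,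
  exists2 e : a, tmul t :* val e = tmul t & t = tmul t ⊗ (e : bim_left a).
Proof.
move=> P t; have [s ts] := tens_sumP t.
have [|e ae se] := @has_unit_seq _ _ _ _ _ T P B^c^o _ s (fun p => val p.2).
  by move=> p _; have [f af pf] := P _ (rat_ideal_valP p.2); exists f.
exists (ideal_elt ae).
  rewrite ts tmul_sum rscale_suml; apply: eq_big_seq => p ps.
  by rewrite tmul_pure rscaleA; congr (_ :* _); exact: se.
rewrite {2}ts tmul_sum tpure_suml ts; apply: eq_big_seq => p ps.
rewrite tmul_pure tpure_bal; congr (_ ⊗ _).
by apply: smval_inj; rewrite -[LHS](se p ps).
Qed.

(* Both tensors are simple, and a common unit of their second factors *)
(* replaces both of these. *)
Lemma tmul_inj : ideal_local_units T -> injective tmul.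
Proof.
move=> P t u tu; have [e te Et] := tmul_unit P t; have [f uf Eu] := tmul_unit P u.
have [g [ag eg fg]] := ideal_common_unit P (rat_ideal_valP e) (rat_ideal_valP f).
have key (x : a) (m : M) : val x * g = val x -> m :* val x = m ->
    m ⊗ (x : bim_left a) = m ⊗ (ideal_elt ag : bim_left a).
  move=> xg mx; rewrite -[in RHS]mx tpure_bal; congr (_ ⊗ _).
  by apply: smval_inj; exact: esym xg.
by rewrite Et Eu (key _ _ eg te) (key _ _ fg uf) tu.
Qed.

Section Coaction.
Hypothesis P : ideal_local_units T.
Hypothesis hM : forall m : M, has_unit T m.

Lemma ideal_coact_subproof m : exists t : tens_right M a, tmul t = m.
Proof.
by have [e ae me] := hM m; exists (m ⊗ (ideal_elt ae : bim_left a)); rewrite tmul_pure.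
Qed.

(** The inverse of [tmul], equal to m ⊗ e for any unit e of m. It is both the comultiplication of a
    and the coaction on every module with local units. *)
Definition ideal_coact (m : M) : tens_right M a := projT1 (cid (ideal_coact_subproof m)).

Lemma ideal_coactK : cancel ideal_coact tmul.
Proof. by move=> m; rewrite /ideal_coact; case: cid. Qed.

Lemma ideal_coact_uniq m t : tmul t = m -> ideal_coact m = t.
Proof. by move=> tm; apply: (tmul_inj P); rewrite ideal_coactK. Qed.

Lemma ideal_coactE m (e : a) : m :* val e = m ->
  ideal_coact m = m ⊗ (e : bim_left a).
Proof. by move=> me; apply: ideal_coact_uniq; rewrite tmul_pure. Qed.

Lemma ideal_coact_linear : linear ideal_coact.
Proof.
move=> b m n; have [e [ae xe ne]] := has_unit2 P (hM (m :* b)) (hM n).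
have [f af mf] := hM m; pose e' := ideal_elt ae.
have mb : ideal_coact (m :* b) = ideal_coact m :* b.
  rewrite (@ideal_coactE m (ideal_elt af)) // tens_right_pure.
  apply: ideal_coact_uniq; rewrite tmul_pure.
  by rewrite -[in RHS]mf; exact: esym (rscaleA m f b).
rewrite (@ideal_coactE _ e') ?(@ideal_coactE n e') //; last first.
  by rewrite rscaleDl [X in _ + X]ne [X in X + _]xe.
rewrite tpureDl; congr (_ + _); rewrite -[RHS]mb.
by symmetry; exact: ideal_coactE.
Qed.
HB.instance Definition _ :=
  GRing.isLinear.Build B^c M (tens_right M a) _ ideal_coact ideal_coact_linear.
Definition ideal_coaction : {linear M -> tens_right M a} := ideal_coact.

End Coaction.
End Mul.

Lemma tmul_tmap (M N : lmodType B^c) (f : {linear M -> N}) (t : tens_right M a) :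
  tmul (tmap f idfun t) = f (tmul t).
Proof.
have [s ->] := tens_sumP t; rewrite (tmap_sum f (lmod_id (bim_left a))).
rewrite !tmul_sum raddf_sum; apply: eq_bigr => p _.
rewrite (tmap_pure f (lmod_id (bim_left a))) !tmul_pure.
exact: esym (linear_rscale f _ _).
Qed.

Section Coring.
Hypothesis P : ideal_local_units T.

Lemma rat_ideal_has_unit (x : bim_right a) : has_unit T x.
Proof.
have [e ae xe] := P (rat_ideal_valP x).
by exists e => //; apply: smval_inj.
Qed.

Definition ideal_delta : {linear a -> tens_right a a} :=
  ideal_coaction P rat_ideal_has_unit.

Lemma ideal_deltaE (x e : a) : val x * val e = val x ->
  ideal_delta x = x ⊗ (e : bim_left a).
Proof. by move=> xe; apply: (ideal_coactE P); exact: smval_inj. Qed.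

Lemma ideal_delta_lscale b x : ideal_delta (lscale b x) = tens_lscale b (ideal_delta x).
Proof.
have [e ae xe] := P (rat_ideal_valP x).
rewrite (@ideal_deltaE x (ideal_elt ae)) // tens_lscale_pure.
by apply: ideal_deltaE; rewrite -[RHS]/(b * val x) -[in RHS]xe mulrA.
Qed.

Definition ideal_delta_left : bim_left a -> bim_left (tens_bim a a) := ideal_delta.
Lemma ideal_delta_left_linear : linear ideal_delta_left.
Proof.
move=> b x y; rewrite [LHS]raddfD; congr (_ + _); exact: ideal_delta_lscale.
Qed.
HB.instance Definition _ := GRing.isLinear.Build B (bim_left a)
  (bim_left (tens_bim a a)) _ ideal_delta_left ideal_delta_left_linear.

(** Both sides are m ⊗ (e ⊗ e') with m e = m and e e' = e. *)
Lemma ideal_coactA (M : lmodType B^c) (hM : forall m : M, has_unit T m) (m : M) :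
  tassoc (tmap (ideal_coact hM) idfun (ideal_coact hM m)) =
  tmap idfun (ideal_delta : bim_left a -> bim_left (tens_bim a a)) (ideal_coact hM m).
Proof.
have [e ae me] := hM m; have [e' ae' ee'] := P ae.
have me' : m :* e' = m by rewrite -me rscaleA ee'.
rewrite [in RHS](@ideal_coactE _ P hM m (ideal_elt ae)) //.
rewrite [X in tmap _ _ X](@ideal_coactE _ P hM m (ideal_elt ae')) //.
rewrite (tmap_pure (lmod_id M) ideal_delta_left).
rewrite (tmap_pure (ideal_coaction P hM) (lmod_id (bim_left a))).
rewrite [ideal_coaction P hM m](@ideal_coactE _ P hM m (ideal_elt ae)) //.
rewrite tassoc_pure; congr (_ ⊗ _).
exact: esym (@ideal_deltaE (ideal_elt ae) (ideal_elt ae') ee').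
Qed.

Definition ideal_counit : {linear a -> B^c^o} := @smval _ _ (rat_submodule T B^c^o).

Lemma ideal_counitl c :
  tsum (fun (x : a) (y : bim_left a) => @lscale B a (ideal_counit x) y) (ideal_delta c) = c.
Proof.
have [e ae ce] := P (rat_ideal_valP c).
rewrite (@ideal_deltaE c (ideal_elt ae)) // tsum_pure; first exact: smval_inj.
split=> [x x' y|x y y'|x b y].
- exact: (@lscaleDl B a (val x) (val x') y).
- exact: (@lscaleDr B a (val x) y y').
- exact: esym (@lscaleA B a (val x) b y).
Qed.

Definition ideal_coring : coring a :=
  @Coring B a ideal_delta ideal_counit ideal_delta_lscale (fun b c => erefl)
    (ideal_coactA rat_ideal_has_unit) ideal_counitl (ideal_coactK rat_ideal_has_unit).

Lemma ideal_coring_idempotent : is_idempotent_coring ideal_coring.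
Proof.
split=> // x; first exact: (ideal_coactK rat_ideal_has_unit).
by apply: (ideal_coact_uniq P).
Qed.

End Coring.

Section IdempotentComodules.
Variable E : coring a.
Hypothesis counitE : forall x, counit E x = val x.

Lemma comodule_tmul (M : comodule E) m : tmul (coact M m) = m.
Proof.
rewrite -[RHS](coact1 m) /tmul /tsum.
by apply: eq_bigr => p _; rewrite counitE.
Qed.

Hypothesis P : ideal_local_units T.

Lemma comodule_has_unit (M : comodule E) (m : M) : has_unit T m.
Proof. by rewrite -(comodule_tmul m); exact: tmul_has_unit. Qed.

Lemma comodule_is_rational (M : comodule E) : is_rational T M.
Proof. by move=> m; apply: has_unit_rational; exact: comodule_has_unit. Qed.

Definition comod_to_RatMod : functor (Comod E) (RatMod T) :=
  @Functor (Comod E) (RatMod T) (fun M => FullOb (@comodule_is_rational M))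
    (fun M N f => cm_map f) (fun M => erefl) (fun M N Q g f => erefl).

Lemma comod_to_RatMod_forget :
  comp_functor (RatMod_incl T) comod_to_RatMod = comod_forget E.
Proof. exact: functor_eq. Qed.

Lemma comodule_hom_coact (M N : comodule E) (f : {linear M -> N}) m :
  coact N (f m) = tmap f idfun (coact M m).
Proof. by apply: (tmul_inj P); rewrite tmul_tmap !comodule_tmul. Qed.

End IdempotentComodules.

(** The counit axiom makes a coaction a section of the injective [tmul], so it is unique and every
    linear map is colinear; rational modules carry one because they have local units. *)
Lemma comod_to_RatMod_iso (P : ideal_local_units T) (U : local_units T)
    (cE : forall x, counit (ideal_coring P) x = val x) :
  iso_of_categories (comod_to_RatMod cE P).
Proof.
split=> [|M N]; last first.
  exists (fun f => ComodHom (comodule_hom_coact cE P f)) => f; last exact: linear_eq.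
  exact: comod_hom_eq.
pose hM (N : RatMod T) (m : full_val N) : has_unit T m := U _ m (full_valP N m).
exists (fun N : RatMod T => @Comodule B a (ideal_coring P) (full_val N)
  (ideal_coaction P (hM N)) (ideal_coactA P (hM N)) (ideal_coactK (hM N))) => [M|N]; last exact: full_ob_eq.
case: M => M r rA r1; apply: comodule_eq => m; apply: (ideal_coact_uniq P).
exact: (@comodule_tmul _ cE (Comodule rA r1) m).
Qed.

(** Surjectivity of [U] on objects makes Rat(M) the module underlying a comodule over a, whose
    elements are values of [tmul] and therefore have units. *)
Lemma comodule_local_units (E : coring a) (U : functor (Comod E) (RatMod T)) :
  ideal_local_units T -> is_idempotent_coring E ->
  comp_functor (RatMod_incl T) U = comod_forget E -> iso_of_categories U ->
  local_units T.
Proof.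
move=> P [cE _ _] UE [[V _ VK] _] M m rm.
pose N : RatMod T := FullOb (@Rat_is_rational _ _ _ _ _ T M).
have NE : full_val N = cm_right (V N).
  have <- : full_val (U (V N)) = cm_right (V N).
    by rewrite -[LHS]/(comp_functor (RatMod_incl T) U (V N)) UE.
  by rewrite VK.
have hN (n : full_val N) : has_unit T n.
  by move: n; rewrite NE => n; exact: (@comodule_has_unit _ cE P (V N) n).
have [e ae me] := hN (@smem_sub _ _ (rat_submodule T M) m rm).
by exists e => //; have := congr1 (@smval _ _ _) me.
Qed.

End IdempotentCoring.

Theorem theorem1p10 (K : comPzRingType) (A B : pzRingType)
    (kA : {rmorphism K -> A}) (kB : {rmorphism K -> B})
    (kA_central : forall k a, kA k * a = a * kA k)
    (kB_central : forall k b, kB k * b = b * kB k)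
    (C : bimodule A) (kC : forall k (c : C), lscale (kA k) c = c :* kA k)
    (D : coring C) (iota : {rmorphism A -> B})
    (k_iota : forall k, iota (kA k) = kB k)
    (T : rational_pairing iota D) :
  [<-> exact_functor (Rat_endofunctor T);
       exists (hL : localizing (Ker_Rat T))
              (H : functor (gabriel_quotient hL) (RatMod T)),
         equivalence H /\
         Rat_functor T = comp_functor H (gabriel_functor hL);
       adjoint (Rat_functor T)
         (comp_functor (hom_functor (rat_ideal T)) (RatMod_incl T));
       [/\ rat_ideal_idempotent T,
           flat (quot_lmod (rat_left_ideal T)) &
           exists E : coring (rat_ideal T),
             is_idempotent_coring E /\
             exists U : functor (Comod E) (RatMod T),
               [/\ comp_functor (RatMod_incl T) U = comod_forget E,
                   iso_of_categories U &
                   iso_of_categories (comod_RatMod T)]];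
       [/\ pure (rat_left_ideal T),
           rat_ideal_idempotent T &
           coring_rat_ideal_full T]].
Proof.
tfae.
- move=> /exact_local_units U.
  exists (Ker_Rat_localizing U), (gab_rat_functor U).
  by split; [exact: gab_rat_equivalence|exact: gab_rat_functorE].
- by move=> [hL [H [/gabriel_local_units HU /HU]]]; exact: local_units_adjoint.
- move=> /adjoint_local_units U; have P := local_units_ideal U.
  split; [exact: ideal_local_units_idempotent|exact: ideal_local_units_flat|].
  have cE (x : rat_ideal T) : counit (ideal_coring P) x = rat_ideal_val x by [].
  exists (ideal_coring P); split; first exact: ideal_coring_idempotent.
  exists (comod_to_RatMod cE P); split.
  + exact: comod_to_RatMod_forget.
  + exact: comod_to_RatMod_iso.
  + exact: comod_RatMod_iso.
- move=> [idem /flat_ideal_local_units P [E [cE [U [UE Uiso _]]]]].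
  split=> //; first exact: ideal_local_units_pure.
  exact: local_units_full (comodule_local_units P cE UE Uiso).
- move=> [/pure_ideal_local_units P _ full]; apply: local_units_exact.
  exact: full_local_units.
Qed.
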